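(* Let $K$ be an algebraically closed field, and let $A$ be the free noncommutative $K$-algebra generated in degree one by elements $x,y$. Let $\xi$ be a natural number. Let $I$ denote the ideal generated in $A$ by homogeneous elements $f_1,f_2,\dots,f_\xi\in A$. Suppose that, for each $i$, there are exactly $r_i$ elements among $f_1,\dots,f_\xi$ with degrees larger than $2^i$ and not exceeding $2^{i+1}$. Assume that there are no elements among $f_1,\dots,f_\xi$ with degree $k$ if $2^n+2^{n-1}+2^{n-2}<k<2^{n+1}+2^n$ for some $n$. Denote $Y=\{n: r_n\neq 0\}$. Suppose that for all $n\in Y$ and $m\in\{0\}\cup Y$ with $m<n$ we have $$2^{3n+4}\prod_{i<n,\ i\in Y} r_i^{32}<r_n<2^{2^{n-m-3}}.$$ Assume moreover that for each $n\in Y$ there is a natural number $e(n)$ with $1\le e(n)\le n-1$ such that the sets $S_n=\{n-1-e(n),\dots,n-1\}$, $n\in Y$, are disjoint and, for all $n\in Y$, $$r_n\,2^{3n+4}\prod_{k<n,\ k\in Y}2^{2^{e(k)+2}}\le 2^{2^{e(n)-1}}.$$ Then $A/I$ contains a free noncommutative graded subalgebra in two generators, and these generators are (images of) monomials of the same degree. In particular, $A/I$ is not Jacobson radical. Moreover, $A/I$ can be homomorphically mapped onto a prime, infinite-dimensional, Noetherian, graded algebra with linear growth.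
   Context: Graded means graded by the additive semigroup of natural numbers. A graded $K$-algebra $R$, with homogeneous components $R(n)$, has linear growth if there is a number $c$ such that $\dim_K R(n)\le c$ for all $n$. A monomial of degree $k$ is a product $x_1\cdots x_k$ with all $x_i\in\{x,y\}$. An algebra is Jacobson radical if it equals its own Jacobson radical.
   Formalization: The generators f_1,…,f_ξ are additionally assumed to have degrees larger than 1; without this the claim is false, e.g. for ξ = 1 and f_1 = x, where Y is empty and A/I = K[y] is commutative. *)

(* Defs.v *)
From HB Require Import structures.
From mathcomp Require Import all_boot all_order all_algebra.
From mathcomp Require Import finmap.
From mathcomp.multinomials Require Import monalg.

Set Implicit Arguments.
Unset Strict Implicit.
Unset Printing Implicit Defensive.

Import GRing.Theory.
Local Open Scope ring_scope.

(* The unital free associative K-algebra on n noncommuting variables: the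
   monoid algebra of the free monoid on 'I_n.  The alias carries the algType
   structure, which monalg declares only for commutative monoids. *)
Definition free_alg (K : comNzRingType) (n : nat) : Type :=
  {malg K[{fmonom 'I_n}]}.

HB.instance Definition _ (K : comNzRingType) (n : nat) :=
  GRing.Lalgebra.on (free_alg K n).

Fact free_alg_scalerAr (K : comNzRingType) (n : nat) (k : K)
  (p q : free_alg K n) : k *: (p * q) = p * (k *: q).
Proof.
apply/malgP => m; rewrite mcoeffZ mcoeffMl.
rewrite (mcoeffMlw m (fsubset_refl (msupp p)) (msuppZ_le k q)).
rewrite mulr_sumr; apply: eq_bigr => m1 _.
rewrite mulr_sumr; apply: eq_bigr => m2 _.
by rewrite mcoeffZ mulrnAr mulrCA.
Qed.

HB.instance Definition _ (K : comNzRingType) (n : nat) :=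
  GRing.Lalgebra_isAlgebra.Build K (free_alg K n) (@free_alg_scalerAr K n).

Section FreeAlgebra.
Context (K : comNzRingType).

Definition monomial (n k : nat) (w : k.-tuple 'I_n) : free_alg K n :=
  << FMonom w >>.

(* The component of degree k, each variable having degree 1; 0 lies in all of
   them. *)
Definition homogeneous (n k : nat) (p : free_alg K n) : Prop :=
  forall m, m \in msupp p -> fdeg m = k.

Definition augmentation (n : nat) (p : free_alg K n) : Prop :=
  mcoeff mone p = 0.

(* The unital algebra morphism from the free algebra sending 'X_i to b i. *)
Definition free_eval (R : algType K) (n : nat) (b : 'I_n -> R)
    (p : free_alg K n) : R :=
  mmap (in_alg R) (fun m => \prod_(i <- fmonom_val m) b i) p.

End FreeAlgebra.

Section Algebras.
Context (K : fieldType) (R : algType K).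
Implicit Types (S L V : R -> Prop).

Definition subspace V : Prop :=
  V 0 /\ forall (a : K) x y, V x -> V y -> V (a *: x + y).

(* S is meant to be a subalgebra of R, possibly without unit; taking for S the
   whole of R gives the usual left ideals of R. *)
Definition left_ideal_in S L : Prop :=
  [/\ subspace L, forall x, L x -> S x & forall s x, S s -> L x -> L (s * x)].

Definition whole : R -> Prop := fun _ => True.

Definition left_ideal L : Prop := left_ideal_in whole L.

Definition right_ideal L : Prop :=
  subspace L /\ forall s x, L x -> L (x * s).

Definition ideal L : Prop := left_ideal L /\ right_ideal L.

Definition generated_ideal (J : Type) (f : J -> R) (x : R) : Prop :=
  forall L, ideal L -> (forall j, L (f j)) -> L x.

(* L is modular when S / L has a right unit e; this always holds when S has
   a unit, so that for S := whole these are the maximal left ideals of R. *)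
Definition maximal_modular_left_ideal S L : Prop :=
  [/\ left_ideal_in S L,
      exists e, S e /\ forall s, S s -> L (s - s * e),
      exists s, S s /\ ~ L s
    & forall L', left_ideal_in S L' -> (forall x, L x -> L' x) ->
        (exists x, L' x /\ ~ L x) -> forall s, S s -> L' s].

Definition jacobson_radical S (x : R) : Prop :=
  S x /\ forall L, maximal_modular_left_ideal S L -> L x.

Definition is_jacobson_radical S : Prop :=
  forall x, jacobson_radical S x <-> S x.

Definition acc (P : (R -> Prop) -> Prop) : Prop :=
  forall L : nat -> R -> Prop,
    (forall n, P (L n)) -> (forall n x, L n x -> L n.+1 x) ->
    exists N, forall n, (N <= n)%N -> forall x, L n x -> L N x.

Definition noetherian : Prop := acc left_ideal /\ acc right_ideal.

Definition prime_algebra : Prop :=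
  forall P Q, ideal P -> ideal Q ->
    (forall x y, P x -> Q y -> x * y = 0) ->
    (forall x, P x -> x = 0) \/ (forall x, Q x -> x = 0).

(* For a subspace V; a spanning family of fewer than c vectors can be padded
   with 0. *)
Definition dim_le V (c : nat) : Prop :=
  exists b : 'I_c -> R, (forall i, V (b i)) /\
    forall x, V x -> exists a : 'I_c -> K, x = \sum_i a i *: b i.

Definition infinite_dimensional : Prop := forall c, ~ dim_le whole c.

Definition is_grading (G : nat -> R -> Prop) : Prop :=
  [/\ forall n, subspace (G n),
      G 0%N 1,
      forall m n x y, G m x -> G n y -> G (m + n)%N (x * y),
      forall x, exists N (c : nat -> R),
        (forall n, G n (c n)) /\ x = \sum_(n < N) c n
    & forall N (c : nat -> R), (forall n, G n (c n)) ->
        \sum_(n < N) c n = 0 -> forall n, (n < N)%N -> c n = 0].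

Definition linear_growth (G : nat -> R -> Prop) : Prop :=
  exists c, forall n, dim_le (G n) c.

Definition subalgebra S : Prop :=
  [/\ subspace S, S 1 & forall x y, S x -> S y -> S (x * y)].

Definition graded_subspace (G : nat -> R -> Prop) V : Prop :=
  subspace V /\
  forall x, V x -> exists N (c : nat -> R),
    (forall n, G n (c n) /\ V (c n)) /\ x = \sum_(n < N) c n.

Definition freely_generated S (n : nat) (b : 'I_n -> R) : Prop :=
  (forall x, S x <-> exists p, x = free_eval b p) /\ injective (free_eval b).

End Algebras.

Arguments whole {K R}.

(* pi : A -> R exhibits R as the quotient algebra A / I. *)
Definition is_quotient (K : fieldType) (A R : algType K) (I : A -> Prop)
    (pi : A -> R) : Prop :=
  (forall x, exists a, x = pi a) /\ forall a, pi a = 0 <-> I a.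

Definition direct_image (A R : Type) (pi : A -> R) (V : A -> Prop) (x : R) :
    Prop :=
  exists2 a, V a & x = pi a.

(* Main.v *)
(* Work with linear functionals on words.  Suppose that P is a family of
   functionals on words of a fixed length D such that all tensor products of
   members of P vanish on every shift of every relation.  Two members of P that
   are independent then yield two words of length D generating a free
   subalgebra.

   Such families are built one n in Y at a time.  Let Phi be the space of tensor
   products of length B = 2^n of the previous family; its dimension is
   N = 2^(2^(e(n)+1)).  A relation of degree d with 3B/2 <= d <= 7B/4, placed
   across blocks of length B, either covers a whole block or lies inside two
   adjacent blocks.  Since cutting a word splits a functional of Phi into few
   pure tensors, a window of the first kind gives few linear equations on the
   functional of the covered block, and one of the second kind gives few
   bilinear equations on the two functionals.  Choose p_0 satisfying the
   equations of the first kind, and then, p_0 being fixed, choose four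
   independent p_i satisfying the equations of the first kind and those of the
   second kind for (p_0, p_i) and (p_i, p_0), which have become linear.  The
   products of p_0 and p_i form the next family, for words of length 2B.

   For the Noetherian image, fix one functional p of the last family, and let C
   be the quotient by the largest ideal on which all powers of p vanish.  It is
   graded, and multiplicativity of the powers of p makes it prime.  As K is
   infinite, a generic homogeneous z of degree D is regular in C.  The spaces of
   leading coefficients of a one-sided ideal therefore have dimensions that grow
   along multiplication by z and are bounded, so ascending chains stabilize. *)

Require Import Defs.
From HB Require Import structures.
From mathcomp Require Import all_boot all_order all_algebra.
From mathcomp Require Import finmap generic_quotient ring_quotient.
From mathcomp.multinomials Require Import monalg.
From mathcomp Require Import zify ring.
From mathcomp Require Import boolp classical_sets.

Set Implicit Arguments.
Unset Strict Implicit.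
Unset Printing Implicit Defensive.

Import GRing.Theory.

(** * Product functionals on words *)

Section Padding.
Local Open Scope ring_scope.

(** Ranks and dimensions are bounded through families indexed by ['I_m]; a family over a smaller
    finite type is padded with zeros. *)
Lemma ord_pad (V : zmodType) (J : finType) m : (#|J| <= m)%N ->
  exists g : 'I_m -> option J,
    forall h : J -> V, \sum_k oapp h 0 (g k) = \sum_j h j.
Proof.
move=> le_Jm; pose g (k : 'I_m) : option J :=
  omap enum_val (insub (val k) : option 'I_#|J|).
exists g => h; rewrite -(big_mkord xpredT (fun k =>
  oapp h 0 (omap enum_val (insub k : option 'I_#|J|)))).
rewrite (big_cat_nat (leq0n _) le_Jm) //= [X in _ + X]big_nat_cond [X in _ + X]big1 ?addr0.
  rewrite big_mkord [RHS](reindex_onto enum_val enum_rank) /=; last first.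
    by move=> j _; rewrite enum_rankK.
  apply: eq_big => [i|i _]; first by rewrite enum_valK eqxx.
  by rewrite valK.
by move=> k /andP[/andP[le_Jk _] _]; rewrite insubF //= ltnNge le_Jk.
Qed.

End Padding.

Section Functionals.
Local Open Scope ring_scope.
Variables (K : fieldType) (T : finType).
Local Notation word := (seq T).
Implicit Types (p : word -> K) (ps : seq (word -> K)) (w x y z v : word).

Fixpoint tens_rec D ps w : K :=
  if ps is p :: ps' then p (take D w) * tens_rec D ps' (drop D w) else 1.

(** The value 0 outside length [size ps * D] makes multilinearity and regrouping hold for all words,
    without side conditions on lengths. *)
Definition tens D ps w : K :=
  if size w == (size ps * D)%N then tens_rec D ps w else 0.

Lemma tens_size D ps w : size w != (size ps * D)%N -> tens D ps w = 0.
Proof. by rewrite /tens => /negPf ->. Qed.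

Lemma tens_nil D : tens D [::] [::] = 1.
Proof. by []. Qed.

Lemma tens_cons D p ps x y : size x = D ->
  tens D (p :: ps) (x ++ y) = p x * tens D ps y.
Proof.
move=> sx; rewrite /tens size_cat sx /= mulSn eqn_add2l.
by case: eqP => // _; rewrite ?mulr0 // -sx take_size_cat // drop_size_cat.
Qed.

Lemma tens_cat D ps1 ps2 x y : size x = (size ps1 * D)%N ->
  tens D (ps1 ++ ps2) (x ++ y) = tens D ps1 x * tens D ps2 y.
Proof.
elim: ps1 x => [|p ps1 IH] x sx.
  by rewrite (size0nil sx) tens_nil mul1r.
rewrite -(cat_take_drop D x) /= -catA.
have st : size (take D x) = D by rewrite size_takel // sx /= mulSn leq_addr.
rewrite !tens_cons // IH ?mulrA // size_drop sx /= mulSn addKn //.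
Qed.

Lemma tens1 D p x : size x = D -> tens D [:: p] x = p x.
Proof. by move=> sx; rewrite -(cats0 x) tens_cons // tens_nil mulr1 cats0. Qed.

Lemma tens2 D p q x y : size x = D -> size y = D ->
  tens D [:: p; q] (x ++ y) = p x * q y.
Proof. by move=> sx sy; rewrite tens_cons // tens1. Qed.

Lemma tens3 D p q r x y z : size x = D -> size y = D -> size z = D ->
  tens D [:: p; q; r] (x ++ y ++ z) = p x * (q y * r z).
Proof. by move=> sx sy sz; rewrite tens_cons // tens2. Qed.

(** Associativity of the tensor product: it lets a family on longer blocks inherit the annihilation
    of relations from the family it is built from. *)
Lemma tens_flatten D k (pss : seq (seq (word -> K))) w :
  all (fun ps => size ps == k) pss ->
  tens (k * D) (map (tens D) pss) w = tens D (flatten pss) w.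
Proof.
elim: pss w => [|ps pss IH] w; first by rewrite /tens !mul0n.
case/andP=> /eqP sps spss.
have szf : size (flatten pss) = (size pss * k)%N.
  elim: (pss) spss => //= a l IHl /andP[/eqP sa sl].
  by rewrite size_cat IHl // mulSn sa.
have [sw|sw] := eqVneq (size w) (size (ps :: pss) * (k * D))%N; last first.
  by rewrite !tens_size ?size_map //= size_cat szf sps -mulSn -mulnA.
rewrite -(cat_take_drop (k * D) w).
have st : size (take (k * D) w) = (k * D)%N.
  by rewrite size_takel // sw /= mulSn leq_addr.
by rewrite tens_cons // IH // tens_cat // sps.
Qed.

Lemma tens_lin (I : finType) D ps1 ps2 (t : I -> K) (P : I -> word -> K) w :
  tens D (ps1 ++ (fun u => \sum_i t i * P i u) :: ps2) w
  = \sum_i t i * tens D (ps1 ++ P i :: ps2) w.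
Proof.
have [sw|sw] := eqVneq (size w) ((size ps1 + (size ps2).+1) * D)%N; last first.
  rewrite tens_size ?size_cat //= big1 // => i _.
  by rewrite tens_size ?mulr0 ?size_cat.
rewrite -(cat_take_drop (size ps1 * D) w).
rewrite -(cat_take_drop D (drop (size ps1 * D) w)).
have st : size (take (size ps1 * D) w) = (size ps1 * D)%N.
  by rewrite size_takel // sw mulnDl leq_addr.
have st' : size (take D (drop (size ps1 * D) w)) = D.
  by rewrite size_takel // size_drop sw mulnDl addKn mulSn leq_addr.
rewrite tens_cat // tens_cons // mulr_suml mulr_sumr.
by apply: eq_bigr => i _; rewrite tens_cat // tens_cons //; ring.
Qed.

Definition kills d (F : word -> K) p : Prop :=
  forall x z, \sum_(w : d.-tuple T) F w * p (x ++ w ++ z) = 0.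

Lemma eq_kills d F p q : p =1 q -> kills d F p -> kills d F q.
Proof.
move=> pq kp x z; rewrite -[RHS](kp x z).
by apply: eq_bigr => w _; rewrite pq.
Qed.

Lemma kills_lin d F (I : finType) (t : I -> K) (P : I -> word -> K) :
  (forall i, kills d F (P i)) -> kills d F (fun w => \sum_i t i * P i w).
Proof.
move=> kP x z; under eq_bigr => w _ do rewrite mulr_sumr.
rewrite exchange_big big1 //= => i _.
under eq_bigr => w _ do rewrite mulrCA.
by rewrite -mulr_sumr kP mulr0.
Qed.

End Functionals.

(** * Ranks of functionals across a cut of the word *)

Section Cuts.
Local Open Scope ring_scope.
Variables (K : fieldType) (T : finType).
Local Notation word := (seq T).

(* A bound on the rank of the cut before the last a letters: the functionals
   v |-> P i (y ++ v), for all i and y, lie in one m-dimensional space. *)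
Definition sufcut (I : Type) (P : I -> word -> K) (L a m : nat) : Prop :=
  exists (g : I -> 'I_m -> word -> K) (h : 'I_m -> word -> K),
    forall i y v, size v = a -> (size y + a)%N = L ->
      P i (y ++ v) = \sum_j g i j y * h j v.

Definition precut (I : Type) (P : I -> word -> K) (L a m : nat) : Prop :=
  exists (g : I -> 'I_m -> word -> K) (h : 'I_m -> word -> K),
    forall i y v, size v = a -> (size y + a)%N = L ->
      P i (v ++ y) = \sum_j g i j y * h j v.

Lemma sufcut_fin (I : Type) (J : finType) (P : I -> word -> K) L a m
    (g : I -> J -> word -> K) (h : J -> word -> K) :
  (#|J| <= m)%N ->
  (forall i y v, size v = a -> (size y + a)%N = L ->
     P i (y ++ v) = \sum_j g i j y * h j v) ->
  sufcut P L a m.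
Proof.
move=> /(ord_pad K)[f fE] Pgh.
exists (fun i k y => oapp (fun j => g i j y) 0 (f k)).
exists (fun k v => oapp (fun j => h j v) 0 (f k)) => i y v sv sy.
rewrite Pgh // -(fE (fun j => g i j y * h j v)).
by apply: eq_bigr => k _; case: (f k) => //=; rewrite mulr0.
Qed.

Lemma precut_fin (I : Type) (J : finType) (P : I -> word -> K) L a m
    (g : I -> J -> word -> K) (h : J -> word -> K) :
  (#|J| <= m)%N ->
  (forall i y v, size v = a -> (size y + a)%N = L ->
     P i (v ++ y) = \sum_j g i j y * h j v) ->
  precut P L a m.
Proof.
move=> /(ord_pad K)[f fE] Pgh.
exists (fun i k y => oapp (fun j => g i j y) 0 (f k)).
exists (fun k v => oapp (fun j => h j v) 0 (f k)) => i y v sv sy.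
rewrite Pgh // -(fE (fun j => g i j y * h j v)).
by apply: eq_bigr => k _; case: (f k) => //=; rewrite mulr0.
Qed.

Lemma sufcut_leq (I : Type) (P : I -> word -> K) L a m n :
  (m <= n)%N -> sufcut P L a m -> sufcut P L a n.
Proof.
by move=> le_mn [g [h Pgh]]; apply: (@sufcut_fin _ 'I_m) Pgh; rewrite card_ord.
Qed.

Lemma precut_leq (I : Type) (P : I -> word -> K) L a m n :
  (m <= n)%N -> precut P L a m -> precut P L a n.
Proof.
by move=> le_mn [g [h Pgh]]; apply: (@precut_fin _ 'I_m) Pgh; rewrite card_ord.
Qed.

(** For [a = L] the prefix is empty, so the functionals themselves span. *)
Lemma sufcut_full (I : finType) (P : I -> word -> K) L : sufcut P L L #|I|.
Proof.
apply: (@sufcut_fin _ I _ _ _ _ (fun i j y => (i == j)%:R) P) => // i y v sv.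
rewrite -[RHS]add0n => /addIn/size0nil ->.
rewrite (bigD1 i) //= eqxx mul1r big1 ?addr0 // => j /negPf.
by rewrite eq_sym => ->; rewrite mul0r.
Qed.

Lemma precut_full (I : finType) (P : I -> word -> K) L : precut P L L #|I|.
Proof.
apply: (@precut_fin _ I _ _ _ _ (fun i j y => (i == j)%:R) P) => // i y v sv.
rewrite -[RHS]add0n => /addIn/size0nil ->.
rewrite (bigD1 i) //= eqxx mul1r big1 ?addr0 ?cats0 // => j /negPf.
by rewrite eq_sym => ->; rewrite mul0r.
Qed.

Section Language.
Variables (I X : Type) (Y : finType) (P : I -> word -> K) (D a m k h : nat).
Variables (c : X -> seq I) (s : X -> Y) (r : Y -> seq I).
Hypotheses (sc : forall x, size (c x) = k) (lt_hk : (h < k)%N).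
Hypotheses (le_aD : (a <= D)%N) (sr : forall y, size (r y) = h).

(** The cut passes through one letter, whose functional splits into [m] pure tensors; the [h]
    letters after it take at most [#|Y|] values. Restricting the words over the index alphabet to
    the [c x] covers both full tensor powers and the pairs of words of [stage_power]. *)
Lemma sufcut_lang :
  (forall x, drop (k - h) (c x) = r (s x)) -> sufcut P D a m ->
  sufcut (fun x => tens D (map P (c x))) (k * D) (h * D + a) (m * #|Y|).
Proof.
move=> cr [g [f Pgf]]; pose b := (k - h).-1.
(* The letters [take b (c x)] lie left of the cut, and letter [b] is the one cut. The factor
   [s x == j.2] selects the actual tail among all elements of [Y]. *)
apply: (@sufcut_fin _ ('I_m * Y)%type _ _ _ _
  (fun x j y => if drop b (c x) is i :: _ then
     tens D (map P (take b (c x))) (take (b * D) y) *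
     (g i j.1 (drop (b * D) y) * (s x == j.2)%:R) else 0)
  (fun j v => f j.1 (take a v) * tens D (map P (r j.2)) (drop a v))).
  by rewrite card_prod card_ord.
move=> x y v sv sy.
have kE : k = (b.+1 + h)%N by rewrite /b; lia.
have cE : drop b.+1 (c x) = r (s x) by rewrite -cr /b prednK // subn_gt0.
case dE: (drop b (c x)) => [|i l].
  by move: (congr1 size dE); rewrite size_drop sc /=; lia.
have lE : l = r (s x) by rewrite -cE -addn1 addnC -drop_drop dE drop1.
rewrite -{1}(cat_take_drop b (c x)) dE lE map_cat /=.
have sb : size (take b (c x)) = b by rewrite size_takel // sc kE; lia.
have sy' : size y = (b * D + (D - a))%N by move: sy; rewrite kE; nia.
have e1 : size (take (b * D) y) = (b * D)%N by rewrite size_takel // sy'; lia.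
have e2 : size (drop (b * D) y) = (D - a)%N by rewrite size_drop sy'; lia.
have e3 : size (take a v) = a by rewrite size_takel // sv; lia.
rewrite -{1}(cat_take_drop (b * D) y) -{1}(cat_take_drop a v) -catA.
rewrite tens_cat ?size_map ?sb // [drop _ y ++ _]catA tens_cons; last first.
  by rewrite size_cat e2 e3 subnK.
rewrite Pgf //; last by rewrite e2 subnK.
rewrite (eq_bigr (fun j : 'I_m * Y =>
  (fun i0 j0 => tens D (map P (take b (c x))) (take (b * D) y) *
     (g i i0 (drop (b * D) y) * (s x == j0)%:R) *
  (f i0 (take a v) * tens D (map P (r j0)) (drop a v))) j.1 j.2)) //.
rewrite -(pair_bigA _ (fun i0 j0 => tens D (map P (take b (c x))) (take (b * D) y) *
     (g i i0 (drop (b * D) y) * (s x == j0)%:R) *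
  (f i0 (take a v) * tens D (map P (r j0)) (drop a v)))) /=.
rewrite mulr_suml mulr_sumr; apply: eq_bigr => j _.
rewrite (bigD1 (s x)) //= eqxx mulr1 big1 ?addr0; first by ring.
by move=> y0 /negPf; rewrite eq_sym => ->; rewrite !mulr0 mul0r.
Qed.

Lemma precut_lang :
  (forall x, take h (c x) = r (s x)) -> precut P D a m ->
  precut (fun x => tens D (map P (c x))) (k * D) (h * D + a) (m * #|Y|).
Proof.
move=> cr [g [f Pgf]].
apply: (@precut_fin _ ('I_m * Y)%type _ _ _ _
  (fun x j y => if drop h (c x) is i :: l then
     (g i j.1 (take (D - a) y) * tens D (map P l) (drop (D - a) y)) *
     (s x == j.2)%:R else 0)
  (fun j v => tens D (map P (r j.2)) (take (h * D) v) * f j.1 (drop (h * D) v))).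
  by rewrite card_prod card_ord.
move=> x y v sv sy.
case dE: (drop h (c x)) => [|i l].
  by move: (congr1 size dE); rewrite size_drop sc /=; lia.
rewrite -{1}(cat_take_drop h (c x)) dE cr map_cat /=.
have sl : size l = (k - h).-1.
  by have := congr1 size dE; rewrite size_drop sc /= => ->.
have sy' : size y = ((k - h).-1 * D + (D - a))%N by move: sy; nia.
have e1 : size (take (h * D) v) = (h * D)%N by rewrite size_takel // sv; lia.
have e2 : size (drop (h * D) v) = a by rewrite size_drop sv; lia.
have e3 : size (take (D - a) y) = (D - a)%N by rewrite size_takel // sy' leq_addl.
rewrite -{1}(cat_take_drop (h * D) v) -{1}(cat_take_drop (D - a) y) -catA.
rewrite tens_cat ?size_map ?sr // catA tens_cons; last first.
  by rewrite size_cat e2 e3 subnKC.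
rewrite Pgf //; last by rewrite e3 subnK.
rewrite (eq_bigr (fun j : 'I_m * Y =>
  (fun i0 j0 => g i i0 (take (D - a) y) * tens D (map P l) (drop (D - a) y) *
     (s x == j0)%:R *
  (tens D (map P (r j0)) (take (h * D) v) * f i0 (drop (h * D) v))) j.1 j.2)) //.
rewrite -(pair_bigA _ (fun i0 j0 =>
   g i i0 (take (D - a) y) * tens D (map P l) (drop (D - a) y) *
     (s x == j0)%:R *
  (tens D (map P (r j0)) (take (h * D) v) * f i0 (drop (h * D) v)))) /=.
rewrite mulr_suml mulr_sumr; apply: eq_bigr => j _.
rewrite (bigD1 (s x)) //= eqxx mulr1 big1 ?addr0; first by ring.
by move=> y0 /negPf; rewrite eq_sym => ->; rewrite mulr0 mul0r.
Qed.

End Language.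

Section Power.
Variables (q D m k : nat) (P : 'I_q -> word -> K).
Hypothesis D_gt0 : (0 < D)%N.

Let Phi (c : k.-tuple 'I_q) := tens D (map P c).

(** The [a %/ D] letters after the cut are arbitrary, hence the factor [q ^ (a %/ D)]; if they make
    up the whole word, no letter is cut. *)
Lemma sufcut_tens a : (forall b, (b < D)%N -> sufcut P D b m) -> (0 < m)%N ->
  (a <= k * D)%N -> sufcut Phi (k * D) a (m * q ^ (a %/ D)).
Proof.
move=> Pm m_gt0 le_a; have := divn_eq a D; set h := (a %/ D)%N => aE.
have lt_r : (a %% D < D)%N by rewrite ltn_mod.
have [lt_hk|le_kh] := ltnP h k; last first.
  have -> : a = (k * D)%N by nia.
  apply: sufcut_leq (sufcut_full _ _); rewrite card_tuple card_ord.
  have -> : k = h by nia.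
  by rewrite leq_pmull.
have sz (x : k.-tuple 'I_q) : size (drop (k - h) x) == h.
  by rewrite size_drop size_tuple; apply/eqP; lia.
have -> : (q ^ h)%N = #|{: h.-tuple 'I_q}| by rewrite card_tuple card_ord.
rewrite {1}aE; apply: (@sufcut_lang _ _ _ _ _ _ _ _ _ (fun x => tval x)
  (fun x => Tuple (sz x)) (fun y => tval y)) => //.
- by move=> x; rewrite size_tuple.
- exact: ltnW.
- exact: (Pm _ lt_r).
Qed.

Lemma precut_tens a : (forall b, (b < D)%N -> precut P D b m) -> (0 < m)%N ->
  (a <= k * D)%N -> precut Phi (k * D) a (m * q ^ (a %/ D)).
Proof.
move=> Pm m_gt0 le_a; have := divn_eq a D; set h := (a %/ D)%N => aE.
have lt_r : (a %% D < D)%N by rewrite ltn_mod.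
have [lt_hk|le_kh] := ltnP h k; last first.
  have -> : a = (k * D)%N by nia.
  apply: precut_leq (precut_full _ _); rewrite card_tuple card_ord.
  have -> : k = h by nia.
  by rewrite leq_pmull.
have sz (x : k.-tuple 'I_q) : size (take h x) == h.
  by rewrite size_takel ?size_tuple //; apply/ltnW.
have -> : (q ^ h)%N = #|{: h.-tuple 'I_q}| by rewrite card_tuple card_ord.
rewrite {1}aE; apply: (@precut_lang _ _ _ _ _ _ _ _ _ (fun x => tval x)
  (fun x => Tuple (sz x)) (fun y => tval y)) => //.
- by move=> x; rewrite size_tuple.
- exact: ltnW.
- by move=> y; rewrite size_tuple.
- exact: (Pm _ lt_r).
Qed.

End Power.

End Cuts.

(** * Linear constraints and windows *)

Section Constraints.
Local Open Scope ring_scope.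
Variables (K : fieldType) (I : finType).
Implicit Types (C : (I -> K) -> Prop).

(** [C] contains a subspace of codimension at most [m], presented by [m] linear forms; counts simply
    add up, whether or not the forms are independent. *)
Definition constr m C : Prop :=
  exists g : 'I_m -> I -> K,
    forall t, (forall x, \sum_c t c * g x c = 0) -> C t.

Lemma constr_fin (J : finType) m C (g : J -> I -> K) : (#|J| <= m)%N ->
  (forall t, (forall x, \sum_c t c * g x c = 0) -> C t) -> constr m C.
Proof.
move=> le_Jm gC.
exists (fun k c => if insub (val k) is Some i then g (enum_val (i : 'I_#|J|)) c
                   else 0) => t tg.
apply: gC => j; have lt_j : (enum_rank j < m)%N by apply: leq_trans le_Jm.
rewrite -[RHS](tg (Ordinal lt_j)) /= valK.
by apply: eq_bigr => c _; rewrite enum_rankK.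
Qed.

Lemma constr_sub m C C' : (forall t, C t -> C' t) -> constr m C -> constr m C'.
Proof. by move=> CC' [g gC]; exists g => t /gC/CC'. Qed.

Lemma constr_and m n C C' :
  constr m C -> constr n C' -> constr (m + n) (fun t => C t /\ C' t).
Proof.
move=> [g gC] [g' gC']; apply: (@constr_fin ('I_m + 'I_n)%type _ _
  (fun x => match x with inl i => g i | inr i => g' i end)).
  by rewrite card_sum !card_ord.
move=> t tg; split; first by apply: gC => x; apply: (tg (inl x)).
by apply: gC' => x; apply: (tg (inr x)).
Qed.

Lemma constr_all (X : finType) m (C : X -> (I -> K) -> Prop) :
  (forall x, constr m (C x)) -> constr (#|X| * m) (fun t => forall x, C x t).
Proof.
move=> /fin_all_exists[g gC].
apply: (@constr_fin (X * 'I_m)%type _ _ (fun j => g j.1 j.2)).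
  by rewrite card_prod card_ord.
by move=> t tg x; apply: gC => i; apply: (tg (x, i)).
Qed.

(** A basis of the solution space has an invertible maximal minor; multiplying by its inverse yields
    solutions dual to the coordinates [c j]. These coordinates become the dual words of the next
    stage. *)
Lemma constr_solve m k C : constr m C -> (m + k <= #|I|)%N ->
  exists (t : 'I_k -> I -> K) (c : 'I_k -> I),
    (forall i, C (t i)) /\ forall i j, t i (c j) = (i == j)%:R.
Proof.
move=> [g gC] le_mk.
pose A : 'M[K]_(#|I|, m) := \matrix_(i, x) g x (enum_val i).
pose B := row_base (kermx A).
have fB : row_full B^T by rewrite /row_full mxrank_tr; exact: row_base_free.
have le_k : (k <= \rank (kermx A))%N.
  by rewrite mxrank_ker; have := rank_leq_col A; lia.
pose M := (rowsub (fullrankfun fB) B^T)^T.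
have uM : M \in unitmx by rewrite unitmx_tr fullrowsub_unit.
pose B' := invmx M *m B.
exists (fun i c => B' (widen_ord le_k i) (enum_rank c)).
exists (fun i => enum_val (fullrankfun fB (widen_ord le_k i))).
split=> [i|i j]; last first.
  rewrite enum_valK -[_ == j]/(widen_ord le_k i == widen_ord le_k j).
  transitivity ((1%:M : 'M[K]_(\rank (kermx A))) (widen_ord le_k i)
    (widen_ord le_k j)); last by rewrite mxE.
  rewrite -(mulVmx uM) !mxE; apply: eq_bigr => l _; congr (_ * _).
  by rewrite !mxE.
apply: gC => x.
have BA : B' *m A = 0.
  have /sub_kermxP BA0 : (B <= kermx A)%MS by rewrite eq_row_base.
  by rewrite /B' -mulmxA BA0 mulmx0.
have := congr1 (fun X : 'M_(_, _) => X (widen_ord le_k i) x) BA.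
rewrite [RHS]mxE mxE => B'A; rewrite -[RHS]B'A.
rewrite (reindex_onto enum_val enum_rank) /=.
  by apply: eq_big => [c|c _]; rewrite enum_valK ?eqxx // [A _ _]mxE.
by move=> c _; rewrite enum_rankK.
Qed.

End Constraints.
Section Windows.
Local Open Scope ring_scope.
Variables (K : fieldType) (T I : finType) (Phi : I -> seq T -> K) (B d : nat).
Variable (F : seq T -> K).
Hypotheses (le_Bd : (3 * B <= 2 * d)%N) (le_dB : (4 * d <= 7 * B)%N).

Definition comb (t : I -> K) (w : seq T) : K := \sum_c t c * Phi c w.

(* window2 and window3 state that a relation placed at offset u vanishes, if it
   lies inside two blocks, resp. covers the middle one of three blocks. *)
Definition window2 u (t t' : I -> K) : Prop :=
  forall x z, size x = u -> (u + d + size z)%N = (2 * B)%N ->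
    \sum_(w : d.-tuple T) F w * tens B [:: comb t; comb t'] (x ++ w ++ z) = 0.

Definition window3 u (t : I -> K) : Prop :=
  forall c c' x z, size x = u -> (2 * B < u + d)%N ->
    (u + d + size z)%N = (3 * B)%N ->
    \sum_(w : d.-tuple T) F w * tens B [:: Phi c; comb t; Phi c'] (x ++ w ++ z)
      = 0.

Lemma sum_lin_exchange (W J : finType) (a : W -> K) (t : J -> K)
    (b : W -> J -> K) (e : W -> K) :
  \sum_c t c * (\sum_w a w * (e w * b w c)) =
  \sum_w a w * (e w * \sum_c t c * b w c).
Proof.
under eq_bigr => c _ do rewrite mulr_sumr.
rewrite exchange_big /=; apply: eq_bigr => w _.
by rewrite !mulr_sumr; apply: eq_bigr => c _; ring.
Qed.

Lemma sum_mul_distr (J J' : finType) (b : K) (h a : J -> K) (h' a' : J' -> K) :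
  b * ((\sum_j h j * a j) * (\sum_j' h' j' * a' j')) =
  \sum_j \sum_j' h j * (h' j' * (b * (a j * a' j'))).
Proof.
rewrite mulr_suml mulr_sumr; apply: eq_bigr => j _.
by rewrite !mulr_sumr; apply: eq_bigr => j' _; ring.
Qed.

(** The outer words [x] and [z] enter only through [m1] and [m2] functionals, so [m1 * m2] bilinear
    equations suffice for all [x] and [z]. *)
Lemma window2_bilinear u m1 m2 : (u + d <= 2 * B)%N ->
  precut Phi B u m1 -> sufcut Phi B (2 * B - d - u) m2 ->
  exists (g : I -> 'I_m1 -> seq T -> K) (g' : I -> 'I_m2 -> seq T -> K),
    forall t t', (forall j j', \sum_(w : d.-tuple T) F w *
      ((\sum_c t c * g c j (take (B - u) w)) *
       (\sum_c t' c * g' c j' (drop (B - u) w))) = 0) -> window2 u t t'.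
Proof.
move=> le_u [g [h gh]] [g' [h' gh']]; exists g, g' => t t' tt0 x z sx sz.
transitivity (\sum_j \sum_j' h j x * (h' j' z *
  \sum_(w : d.-tuple T) F w *
      ((\sum_c t c * g c j (take (B - u) w)) *
       (\sum_c t' c * g' c j' (drop (B - u) w))))); last first.
  by rewrite big1 // => j _; rewrite big1 // => j' _; rewrite tt0 !mulr0.
under [RHS]eq_bigr => j _.
  under eq_bigr => j' _ do rewrite !mulr_sumr.
  rewrite exchange_big /=; over.
rewrite exchange_big /=; apply: eq_bigr => w _.
have sw : size w = d by rewrite size_tuple.
have s1 : size (take (B - u) w) = (B - u)%N by rewrite size_takel // sw; lia.
have s2 : size (drop (B - u) w) = (u + d - B)%N by rewrite size_drop sw; lia.
have -> : x ++ w ++ z = (x ++ take (B - u) w) ++ (drop (B - u) w ++ z).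
  by rewrite -catA [take _ _ ++ _]catA cat_take_drop.
rewrite tens2 ?size_cat ?sx ?s1 ?s2; [|lia|lia].
have e1 c : Phi c (x ++ take (B - u) w) =
    \sum_j g c j (take (B - u) w) * h j x by apply: gh => //; rewrite s1; lia.
have e2 c : Phi c (drop (B - u) w ++ z) =
    \sum_j g' c j (drop (B - u) w) * h' j z by apply: gh'; rewrite ?s2; lia.
have -> : comb t (x ++ take (B - u) w) =
    \sum_j h j x * \sum_c t c * g c j (take (B - u) w).
  rewrite /comb; under eq_bigr => c _ do rewrite e1 mulr_sumr.
  rewrite exchange_big /=; apply: eq_bigr => j _; rewrite mulr_sumr.
  by apply: eq_bigr => c _; ring.
have -> : comb t' (drop (B - u) w ++ z) =
    \sum_j h' j z * \sum_c t' c * g' c j (drop (B - u) w).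
  rewrite /comb; under eq_bigr => c _ do rewrite e2 mulr_sumr.
  rewrite exchange_big /=; apply: eq_bigr => j _; rewrite mulr_sumr.
  by apply: eq_bigr => c _; ring.
exact: sum_mul_distr.
Qed.

Lemma window2_vacuous u t t' : (2 * B < u + d)%N -> window2 u t t'.
Proof. by move=> lt_u x z sx sz; lia. Qed.

(** With [t] fixed, the bilinear equations are linear in the other argument. If the relation does
    not fit into two blocks, there is nothing to solve. *)
Lemma constr_window2r u m1 m2 m t : ((u + d <= 2 * B)%N ->
    [/\ precut Phi B u m1, sufcut Phi B (2 * B - d - u) m2
      & (m1 * m2 <= m)%N]) ->
  constr m (window2 u t).
Proof.
move=> cuts; have [le_u|lt_u] := leqP (u + d) (2 * B); last first.
  by exists (fun _ _ => 0) => t' _; apply: window2_vacuous.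
have [cp cs le_m] := cuts le_u; have [g [g' gg']] := window2_bilinear le_u cp cs.
apply: (@constr_fin _ _ ('I_m1 * 'I_m2)%type _ _ (fun j c =>
  \sum_(w : d.-tuple T) F w * ((\sum_c t c * g c j.1 (take (B - u) w)) *
       g' c j.2 (drop (B - u) w)))).
  by rewrite card_prod !card_ord.
move=> t' t'0; apply: gg' => j j'; have := t'0 (j, j') => /=.
by rewrite sum_lin_exchange.
Qed.

Lemma constr_window2l u m1 m2 m t' : ((u + d <= 2 * B)%N ->
    [/\ precut Phi B u m1, sufcut Phi B (2 * B - d - u) m2
      & (m1 * m2 <= m)%N]) ->
  constr m (window2 u ^~ t').
Proof.
move=> cuts; have [le_u|lt_u] := leqP (u + d) (2 * B); last first.
  by exists (fun _ _ => 0) => t _; apply: window2_vacuous.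
have [cp cs le_m] := cuts le_u; have [g [g' gg']] := window2_bilinear le_u cp cs.
apply: (@constr_fin _ _ ('I_m1 * 'I_m2)%type _ _ (fun j c =>
  \sum_(w : d.-tuple T) F w * ((\sum_c t' c * g' c j.2 (drop (B - u) w)) *
       g c j.1 (take (B - u) w)))).
  by rewrite card_prod !card_ord.
move=> t t0; apply: gg' => j j'; have := t0 (j, j') => /=.
rewrite sum_lin_exchange => t00; rewrite -[RHS]t00; apply: eq_bigr => w _; congr (_ * _).
exact: mulrC.
Qed.

(** Here the pieces of the relation in the outer blocks matter: as functions of these pieces, the
    outer functionals lie in spaces of dimensions at most [m1] and [m2], whatever [c], [c'], [x] and
    [z] are. *)
Lemma constr_window3 u m1 m2 m : ((u < B)%N -> (2 * B < u + d)%N ->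
    [/\ sufcut Phi B (B - u) m1, precut Phi B (u + d - 2 * B) m2
      & (m1 * m2 <= m)%N]) -> (u < B)%N ->
  constr m (window3 u).
Proof.
move=> cuts lt_uB; have [le_u|lt_u] := leqP (u + d) (2 * B).
  by exists (fun _ _ => 0) => t _ c c' x z _; rewrite ltnNge le_u.
have [[g [h gh]] [g' [h' gh']] le_m] := cuts lt_uB lt_u.
pose w1 (w : seq T) := take (B - u) w.
pose w2 (w : seq T) := take B (drop (B - u) w).
pose w3 (w : seq T) := drop B (drop (B - u) w).
apply: (@constr_fin _ _ ('I_m1 * 'I_m2)%type _ _ (fun j c =>
  \sum_(w : d.-tuple T) F w * (h j.1 (w1 w) * h' j.2 (w3 w) * Phi c (w2 w)))).
  by rewrite card_prod !card_ord.
move=> t t0 c c' x z sx _ sz.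
transitivity (\sum_j \sum_j' g c j x * (g' c' j' z *
  \sum_(w : d.-tuple T) F w * (h j (w1 w) * h' j' (w3 w) * comb t (w2 w)))).
  under [RHS]eq_bigr => j _.
    under eq_bigr => j' _ do rewrite !mulr_sumr.
    rewrite exchange_big /=; over.
  rewrite exchange_big /=; apply: eq_bigr => w _.
  have sw : size w = d by rewrite size_tuple.
  have s1 : size (w1 w) = (B - u)%N by rewrite size_takel // sw; lia.
  have s2 : size (w2 w) = B by rewrite size_takel // size_drop sw; lia.
  have s3 : size (w3 w) = (u + d - 2 * B)%N by rewrite !size_drop sw; lia.
  have -> : x ++ w ++ z = (x ++ w1 w) ++ w2 w ++ (w3 w ++ z).
    by rewrite -catA /w1 /w2 /w3 [take B _ ++ _]catA cat_take_drop
               [take _ w ++ _]catA cat_take_drop.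
  rewrite tens3 ?size_cat ?sx ?s1 ?s2 ?s3; [|lia|lia|lia].
  rewrite gh ?s1 ?gh' ?s3 //; [|lia..].
  rewrite mulr_suml mulr_sumr; apply: eq_bigr => j _.
  rewrite !mulr_sumr; apply: eq_bigr => j' _; ring.
rewrite big1 // => j _; rewrite big1 // => j' _.
have := t0 (j, j') => /=; rewrite sum_lin_exchange => t00.
by rewrite [X in _ * (_ * X)]t00 !mulr0.
Qed.

End Windows.

(** * Annihilation of relations by long tensor products *)

Section Chain.
Local Open Scope ring_scope.
Variables (K : fieldType) (T I : finType) (Phi : I -> seq T -> K) (B d : nat).
Variable (F : seq T -> K).
Hypotheses (le_Bd : (3 * B <= 2 * d)%N) (le_dB : (4 * d <= 7 * B)%N).
Hypothesis B_gt0 : (0 < B)%N.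
Variables (S : eqType) (tau : S -> I -> K) (e : rel S).
Hypothesis tau2 : forall s s' u, e s s' -> (u < B)%N ->
  window2 Phi B d F u (tau s) (tau s').
Hypothesis tau3 : forall s u, (u < B)%N -> window3 Phi B d F u (tau s).

Let p s := comb Phi (tau s).

(** Since [B < d] and [u + d < 3 * B], a relation starting at offset [u] of a block meets two or
    three consecutive blocks; the other blocks split off as scalar factors. The compatibility [e] of
    neighbours serves the two-block case. *)
Lemma kills_chain ss : sorted e ss -> kills d F (tens B (map p ss)).
Proof.
move=> srt x z.
have [sz|sz] := eqVneq (size x + d + size z)%N (size ss * B)%N; last first.
  rewrite big1 // => w _; rewrite tens_size ?mulr0 //.
  by rewrite !size_cat size_tuple size_map addnA.
set k := (size x %/ B)%N; set u := (size x %% B)%N.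
have xE : size x = (k * B + u)%N by exact: divn_eq.
have lt_uB : (u < B)%N by rewrite ltn_mod.
have lt_k : (k.+1 < size ss)%N.
  by rewrite -(ltn_pmul2r B_gt0) -sz mulSn; lia.
case dE: (drop k ss) => [|s [|s' l]]; move: (congr1 size dE);
  rewrite size_drop /= => sl; [lia|lia|].
have ssE : ss = take k ss ++ [:: s, s' & l] by rewrite -dE cat_take_drop.
have ess' : e s s' by move: srt; rewrite ssE => /cat_sorted2[_ /= /andP[]].
set l1 := take k ss in ssE.
have sl1 : size l1 = k by rewrite size_takel // ltnW // ltnW.
set x1 := take (k * B) x; set x2 := drop (k * B) x.
have xx : x = x1 ++ x2 by rewrite cat_take_drop.
have sx1 : size x1 = (k * B)%N by rewrite size_takel // xE leq_addr.
have sx2 : size x2 = u by rewrite size_drop xE addKn.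
have sssE : size ss = (k + (size l).+2)%N by lia.
have [le_u|lt_u] := leqP (u + d) (2 * B).
  set b := (2 * B - u - d)%N.
  have le_bz : (b <= size z)%N by move: sz; rewrite sssE xE /b; nia.
  have st : size (take b z) = b by rewrite size_takel.
  rewrite (eq_bigr (fun w : d.-tuple T => tens B (map p l1) x1 *
    tens B (map p l) (drop b z) *
    (F w * tens B [:: p s; p s'] (x2 ++ w ++ take b z)))) => [|w _].
    rewrite -mulr_sumr [X in _ * X](tau2 ess' lt_uB) ?mulr0 //.
    by rewrite st /b; lia.
  have -> : x ++ w ++ z = x1 ++ ((x2 ++ w ++ take b z) ++ drop b z).
    by rewrite -{1}(cat_take_drop b z) {1}xx !catA.
  rewrite ssE map_cat tens_cat ?size_map ?sl1 //.
  rewrite -[map p [:: s, s' & l]]/([:: p s; p s'] ++ map p l) tens_cat.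
    by ring.
  by rewrite !size_cat size_tuple st sx2 /= /b; lia.
case: l => [|s'' l] in sl sssE ssE dE *.
  by move: sz; rewrite sssE xE /=; nia.
set b := (3 * B - u - d)%N.
have le_bz : (b <= size z)%N by move: sz; rewrite sssE xE /b /=; nia.
have st : size (take b z) = b by rewrite size_takel.
rewrite (eq_bigr (fun w : d.-tuple T => tens B (map p l1) x1 *
    tens B (map p l) (drop b z) *
    (F w * tens B [:: p s; p s'; p s''] (x2 ++ w ++ take b z)))) => [|w _].
  rewrite -mulr_sumr; apply/eqP; rewrite mulf_eq0; apply/orP; right; apply/eqP.
  (* [window3] is stated for members of [Phi] in the outer blocks, so [p s] and then [p s''] are
     expanded by multilinearity. *)
  transitivity (\sum_c tau s c * \sum_(w : d.-tuple T)
     F w * tens B [:: Phi c; p s'; p s''] (x2 ++ w ++ take b z)).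
    under [RHS]eq_bigr => c _ do rewrite mulr_sumr.
    rewrite [RHS]exchange_big; apply: eq_bigr => w _ /=.
    rewrite (@tens_lin _ _ _ B [::] [:: p s'; p s''] (tau s) Phi) mulr_sumr.
    by apply: eq_bigr => c _; rewrite mulrCA.
  rewrite big1 // => c _; rewrite [X in _ * X](_ : _ = 0) ?mulr0 //.
  transitivity (\sum_c' tau s'' c' * \sum_(w : d.-tuple T)
     F w * tens B [:: Phi c; p s'; Phi c'] (x2 ++ w ++ take b z)).
    under [RHS]eq_bigr => c' _ do rewrite mulr_sumr.
    rewrite [RHS]exchange_big; apply: eq_bigr => w _ /=.
    rewrite (@tens_lin _ _ _ B [:: Phi c; p s'] [::] (tau s'') Phi) mulr_sumr.
    by apply: eq_bigr => c' _; rewrite mulrCA.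
  rewrite big1 // => c' _; rewrite [X in _ * X](_ : _ = 0) ?mulr0 //.
  by apply: (tau3 s' lt_uB) => //; rewrite ?st /b; lia.
have -> : x ++ w ++ z = x1 ++ ((x2 ++ w ++ take b z) ++ drop b z).
  by rewrite -{1}(cat_take_drop b z) {1}xx !catA.
rewrite ssE map_cat tens_cat ?size_map ?sl1 //.
rewrite -[map p [:: s, s', s'' & l]]/([:: p s; p s'; p s''] ++ map p l).
rewrite tens_cat; first by ring.
by rewrite !size_cat size_tuple st sx2 /= /b; lia.
Qed.

End Chain.

Section Combinations.
Local Open Scope ring_scope.
Variables (K : fieldType) (T : finType) (q k D : nat) (P : 'I_q -> seq T -> K).

Definition powf (c : k.-tuple 'I_q) := tens D (map P c).

Lemma kills_comb d F (ts : seq (k.-tuple 'I_q -> K)) :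
  (forall c : seq 'I_q, kills d F (tens D (map P c))) ->
  kills d F (tens (k * D) (map (comb powf) ts)).
Proof.
move=> kP; rewrite -[map _ _]cats0 -[[::]]/(map powf [::]).
(* The induction carries a list [cs] of pure tensors behind the combinations and expands the last
   combination into it. *)
elim/last_ind: ts [::] => [|ts t IH] cs /=.
  have -> : map powf cs = map (tens D) (map (fun c : k.-tuple 'I_q =>
     map P c) cs) by rewrite -map_comp.
  apply: (@eq_kills _ _ _ _ (tens D (map P (flatten (map val cs))))) => // w.
  rewrite tens_flatten; first by rewrite map_flatten -map_comp.
  by rewrite all_map; apply/allP => c _; rewrite /= size_map size_tuple.
rewrite map_rcons cat_rcons.
apply: (@eq_kills _ _ _ _ (fun w => \sum_c t c * tens (k * D)
   (map (comb powf) ts ++ powf c :: map powf cs) w)) => [w|].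
  by rewrite -tens_lin.
by apply: kills_lin => c; apply: (IH (c :: cs)).
Qed.

End Combinations.

(** * Stages of the construction *)

Section Stages.
Local Open Scope ring_scope.
Variables (K : fieldType) (T : finType).
Local Notation word := (seq T).

(** The words [m] dual to [P] witness independence and finally give the free generators; [ss] and
    [sp] bound the ranks of cuts within one block, on which the number of equations of the next step
    depends. *)
Definition stage (D q ss sp : nat) (Q : nat -> (word -> K) -> Prop) : Prop :=
  exists (P : 'I_q -> word -> K) (m : 'I_q -> word),
    [/\ forall i, size (m i) = D,
        forall i j, P i (m j) = (i == j)%:R,
        forall d F, Q d F -> forall c : seq 'I_q, kills d F (tens D (map P c)),
        forall a, (a < D)%N -> sufcut P D a ss
      & forall a, (a < D)%N -> precut P D a sp].

Lemma stage_sub D q ss sp ss' sp' (Q Q' : nat -> (word -> K) -> Prop) :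
  (ss <= ss')%N -> (sp <= sp')%N -> (forall d F, Q' d F -> Q d F) ->
  stage D q ss sp Q -> stage D q ss' sp' Q'.
Proof.
move=> le_s le_p Q'Q [P [m [sm Pm kP sP pP]]]; exists P, m.
split=> // [d F /Q'Q/kP|a /sP|a /pP] //; first exact: sufcut_leq.
exact: precut_leq.
Qed.

Section Dual.
Variables (q D : nat) (P : 'I_q -> word -> K) (m : 'I_q -> word).
Hypotheses (D_gt0 : (0 < D)%N) (sm : forall i, size (m i) = D).
Hypothesis Pm : forall i j, P i (m j) = (i == j)%:R.

Lemma size_dual (c : seq 'I_q) : size (flatten (map m c)) = (size c * D)%N.
Proof. by elim: c => //= i c IH; rewrite size_cat IH sm mulSn. Qed.

(** Duality is multiplicative: concatenations of the words [m i] are dual to the tensor products of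
    the [P i]. This is the source of freeness. *)
Lemma tens_dual (c c' : seq 'I_q) :
  tens D (map P c) (flatten (map m c')) = (c == c')%:R.
Proof.
have [|ne_s] := eqVneq (size c) (size c'); last first.
  have /negPf -> : c != c' by apply: contraNneq ne_s => ->.
  by rewrite tens_size // size_dual size_map eqn_pmul2r // eq_sym.
elim: c c' => [|i c IH] [|i' c'] //= [sc].
by rewrite tens_cons // Pm IH // eqseq_cons -natrM mulnb.
Qed.

End Dual.

(** The new functionals are [k - 1] copies of the first functional tensored with one of the first
    two. A prefix cut has only constant letters before the cut letter, so [sp] is kept; the tail
    after a suffix cut depends on the last letter alone, which doubles [ss]. *)
Lemma stage_power D q ss sp Q k : (0 < D)%N -> (1 < q)%N -> (0 < k)%N ->
  stage D q ss sp Q -> stage (k * D) 2 (ss * 2) sp Q.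
Proof.
move=> D_gt0 lt_1q k_gt0 [P [m [sm Pm kP sP pP]]].
pose c (i : 'I_2) := rcons (nseq k.-1 (Ordinal (ltnW lt_1q))) (widen_ord lt_1q i).
have sc i : size (c i) = k by rewrite size_rcons size_nseq prednK.
exists (fun i => tens D (map P (c i))), (fun i => flatten (map m (c i))); split.
- by move=> i; rewrite (size_dual sm) sc.
- by move=> i j; rewrite (tens_dual D_gt0 sm Pm) eqseq_rcons eqxx.
- move=> d F QF l.
  apply: (@eq_kills _ _ _ _ (tens D (map P (flatten (map c l))))) => [w|].
    rewrite map_flatten -map_comp -(@tens_flatten _ _ _ k) -?map_comp //.
    by rewrite all_map; apply/allP => i _; rewrite /= size_map sc.
  exact: kP.
- move=> a lt_a; rewrite (divn_eq a D).
  rewrite -[in (ss * 2)%N](card_ord 2).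
  apply: (@sufcut_lang _ _ _ _ _ _ _ _ _ _ _ c id
            (fun i => drop (k - a %/ D) (c i))) => //.
  + by rewrite ltn_divLR.
  + by rewrite ltnW // ltn_mod.
  + by apply: sP; rewrite ltn_mod.
- move=> a lt_a; have lt_k : (a %/ D < k)%N by rewrite ltn_divLR.
  have spE : sp = (sp * #|{: unit}|)%N by rewrite card_unit muln1.
  rewrite (divn_eq a D) [X in precut _ _ _ X]spE.
  apply: (@precut_lang _ _ _ _ _ _ _ _ _ _ _ c (fun _ => tt)
            (fun _ => nseq (a %/ D) (Ordinal (ltnW lt_1q)))) => //.
  + by rewrite ltnW // ltn_mod.
  + by move=> _; rewrite size_nseq.
  + move=> i; rewrite /c -cats1 takel_cat ?size_nseq; last lia.
    by rewrite take_nseq //; lia.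
  + by apply: pP; rewrite ltn_mod.
Qed.

(** With [B = k * D], the two cuts attached to a window have total length [2 * B - d] or [d - B], at
    most three quarters of [B] in both cases; so [M] bounds the equations for one window. Each
    relation and offset imposes three conditions on a new functional: one for its block being
    covered, and one for each order of its pair with [p s0]. *)
Lemma stage_step D q ss sp Q k (J : finType) (d : J -> nat)
    (F : J -> word -> K) M :
  (0 < D)%N -> (1 < q)%N -> (0 < k)%N -> (0 < ss)%N -> (0 < sp)%N ->
  (forall j, (3 * (k * D) <= 2 * d j)%N) ->
  (forall j, (4 * d j <= 7 * (k * D))%N) ->
  (forall a b, (4 * (a + b) <= 3 * (k * D))%N ->
     (ss * q ^ (a %/ D) * (sp * q ^ (b %/ D)) <= M)%N) ->
  (#|J| * (k * D * (3 * M)) + 4 <= q ^ k)%N ->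
  stage D q ss sp Q ->
  stage (2 * (k * D)) 4 (2 * (ss * q ^ k)) (sp * q ^ k)
    (fun d' F' => Q d' F' \/ exists j, d' = d j /\ F' = F j).
Proof.
move=> D_gt0 lt_1q k_gt0 ss_gt0 sp_gt0 le_Bd le_dB le_M le_N.
case=> P [m [sm Pm kP sP pP]]; set B := (k * D)%N in le_Bd le_dB le_M le_N *.
have B_gt0 : (0 < B)%N by rewrite muln_gt0 k_gt0.
have le_div a : (a <= B)%N -> (a %/ D <= k)%N.
  by move=> /(leq_div2r D) le_a; rewrite -(mulnK k D_gt0).
pose Phi := @powf _ _ _ k D P.
have card_I : #|{: k.-tuple 'I_q}| = (q ^ k)%N by rewrite card_tuple card_ord.
have sPhi a : (a <= B)%N -> sufcut Phi B a (ss * q ^ (a %/ D)).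
  by move=> le_aB; apply: sufcut_tens.
have pPhi a : (a <= B)%N -> precut Phi B a (sp * q ^ (a %/ D)).
  by move=> le_aB; apply: precut_tens.
have cuts2 j u : (u + d j <= 2 * B)%N ->
    [/\ precut Phi B u (sp * q ^ (u %/ D)),
        sufcut Phi B (2 * B - d j - u) (ss * q ^ ((2 * B - d j - u) %/ D))
      & (sp * q ^ (u %/ D) * (ss * q ^ ((2 * B - d j - u) %/ D)) <= M)%N].
  move=> le_u; have := le_Bd j; have := le_dB j => le1 le2.
  split; [by apply: pPhi; lia|by apply: sPhi; lia|].
  by rewrite mulnC; apply: le_M; lia.
have C3 (j : J) (u : 'I_B) : constr M (window3 Phi B (d j) (F j) u).
  have := le_Bd j; have := le_dB j => le1 le2.
  apply: (@constr_window3 _ _ _ _ _ _ _ _ _ _ (ss * q ^ ((B - u) %/ D))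
     (sp * q ^ ((u + d j - 2 * B) %/ D))) => // lt_u lt_ud.
  split; [by apply: sPhi; lia|by apply: pPhi; lia|].
  by apply: le_M; lia.
have [t0 [c0 [t0P t0c]]] : exists (t : 'I_1 -> _ -> K) (c : 'I_1 -> _),
    (forall i, forall j (u : 'I_B), window3 Phi B (d j) (F j) u (t i)) /\
    forall i j, t i (c j) = (i == j)%:R.
  apply: (@constr_solve _ _ (#|J| * (#|'I_B| * M)) 1
    (fun t => forall j (u : 'I_B), window3 Phi B (d j) (F j) u t)).
    by apply: constr_all => j; apply: constr_all => u.
  by rewrite card_ord card_I; apply: leq_trans le_N; rewrite !mulnA; nia.
have {t0c} t0c : t0 ord0 (c0 ord0) = 1 by rewrite t0c.
set s0 := t0 ord0 in t0c; set b0 := c0 ord0 in t0c.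
have [t [c [tP tc]]] : exists (t : 'I_4 -> _ -> K) (c : 'I_4 -> _),
    (forall i, forall j (u : 'I_B), [/\ window3 Phi B (d j) (F j) u (t i),
       window2 Phi B (d j) (F j) u s0 (t i)
     & window2 Phi B (d j) (F j) u (t i) s0]) /\
    forall i j, t i (c j) = (i == j)%:R.
  apply: (@constr_solve _ _ (#|J| * (#|'I_B| * (M + (M + M)))) 4
    (fun t => forall j (u : 'I_B), [/\ window3 Phi B (d j) (F j) u t,
       window2 Phi B (d j) (F j) u s0 t & window2 Phi B (d j) (F j) u t s0])).
    apply: constr_all => j; apply: constr_all => u.
    apply: (@constr_sub _ _ _ (fun t => window3 Phi B (d j) (F j) u t /\
       window2 Phi B (d j) (F j) u s0 t /\ window2 Phi B (d j) (F j) u t s0)).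
      by move=> t [? [? ?]].
    apply: constr_and => //; apply: constr_and.
      by apply: constr_window2r => // le_u; apply: cuts2.
    by apply: constr_window2l => // le_u; apply: cuts2.
  by rewrite card_ord card_I; apply: leq_trans le_N; rewrite !mulSn mul0n addn0.
pose p := comb Phi.
(* On the word dual to [b] a combination takes its coordinate at [b], so solutions dual to
   coordinates become functionals dual to words. *)
have pE (r : k.-tuple 'I_q -> K) (b : k.-tuple 'I_q) : p r (flatten (map m b)) = r b.
  rewrite /p /comb (bigD1 b) //= /Phi /powf (tens_dual D_gt0 sm Pm) eqxx mulr1.
  rewrite big1 ?addr0 // => b' /negPf ne_b.
  by rewrite (tens_dual D_gt0 sm Pm) val_eqE ne_b mulr0.
have sE (b : k.-tuple 'I_q) : size (flatten (map m b)) = B.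
  by rewrite (size_dual sm) size_tuple.
(* [None] encodes [s0]. A tensor product of new functionals alternates [None] and [Some i], so
   neighbours contain [s0] exactly once, and these are the pairs that were made compatible. *)
pose tau (s : option 'I_4) := oapp t s0 s.
have PE (cs : seq 'I_4) :
    tens (2 * B) (map (fun i => tens B [:: p s0; p (t i)]) cs) =1
    tens B (map p (map tau (flatten (map (fun i => [:: None; Some i]) cs)))).
  move=> w; rewrite -map_comp map_flatten -map_comp.
  rewrite -(@tens_flatten _ _ _ 2) -?map_comp //.
  by rewrite all_map; apply/allP.
exists (fun i => tens B [:: p s0; p (t i)]).
exists (fun i => flatten (map m b0) ++ flatten (map m (c i))); split.
- by move=> i; rewrite size_cat !sE mul2n addnn.
- by move=> i j; rewrite tens2 ?sE // !pE t0c tc mul1r.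
- move=> d' F' QF cs; apply: (eq_kills (fsym (PE cs))).
  case: QF => [QF|[j [-> ->]]].
    by apply: kills_comb; apply: kP.
  rewrite -map_comp; apply: (@kills_chain _ _ _ _ _ _ _ _ _ _ _ tau
    (fun s s' => isSome s != isSome s')) => //.
  + case=> [i|] [i'|] u //= _ lt_uB; first by case: (tP i j (Ordinal lt_uB)).
    by case: (tP i' j (Ordinal lt_uB)).
  + case=> [i|] u lt_uB; first by case: (tP i j (Ordinal lt_uB)).
    exact: (t0P ord0 j (Ordinal lt_uB)).
  + by elim: cs => //= i [|i' cs] //= ->.
- move=> a lt_a; have [le_aB|lt_Ba] := leqP a B.
    have [g [h gh]] := sPhi a le_aB.
    have le_m : (ss * q ^ (a %/ D) <= 2 * (ss * q ^ k))%N.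
      have : (q ^ (a %/ D) <= q ^ k)%N.
        by rewrite leq_pexp2l ?(ltnW lt_1q) // le_div.
      by move: (q ^ _)%N (q ^ _)%N => ? ?; nia.
    apply: (sufcut_leq le_m).
    exists (fun i j y => p s0 (take B y) * \sum_b t i b * g b j (drop B y)), h.
    move=> i y v sv sy; rewrite -{1}(cat_take_drop B y) -catA.
    have s1 : size (take B y) = B by rewrite size_takel //; lia.
    have s2 : (size (drop B y) + a)%N = B by rewrite size_drop; lia.
    rewrite tens2 ?size_cat ?sv //; under [RHS]eq_bigr do rewrite -mulrA.
    rewrite -mulr_sumr; congr (_ * _); rewrite /p /comb.
    under eq_bigr => b _ do rewrite gh // mulr_sumr.
    rewrite exchange_big /=; apply: eq_bigr => j _.
    by rewrite mulr_suml; apply: eq_bigr => b _; rewrite mulrA.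
  have le_b : (a - B <= B)%N by lia.
  have [g [h gh]] := sPhi (a - B)%N le_b.
  (* The tail includes a whole second block, with four possible [i]; as [(a - B) %/ D < k], a factor
     [q >= 2] is gained, and only a factor 2 remains. *)
  have le_m : (#|{: 'I_(ss * q ^ ((a - B) %/ D)) * 'I_4}| <= 2 * (ss * q ^ k))%N.
    rewrite card_prod !card_ord.
    have lt_k : ((a - B) %/ D < k)%N by rewrite ltn_divLR // -/B; lia.
    have : (q * q ^ ((a - B) %/ D) <= q ^ k)%N.
      by rewrite -expnS leq_pexp2l // (ltnW lt_1q).
    by move: (q ^ _)%N (q ^ _)%N => ? ?; nia.
  apply: (sufcut_fin
    (g := fun i j y => (\sum_b s0 b * g b j.1 y) * (i == j.2)%:R)
    (h := fun j v => h j.1 (take (a - B) v) * p (t j.2) (drop (a - B) v)) le_m).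
  move=> i y v sv sy.
  have s1 : size (take (a - B) v) = (a - B)%N by rewrite size_takel // sv; lia.
  have s2 : size (drop (a - B) v) = B by rewrite size_drop sv; lia.
  rewrite -{1}(cat_take_drop (a - B) v) catA tens2 ?size_cat ?s1 //; last lia.
  transitivity (\sum_j \sum_i' (\sum_b s0 b * g b j y) * (i == i')%:R *
     (h j (take (a - B) v) * p (t i') (drop (a - B) v))); last first.
    by rewrite pair_bigA.
  have ghE b : Phi b (y ++ take (a - B) v) = \sum_j g b j y * h j (take (a - B) v).
    by apply: gh => //; lia.
  have -> : p s0 (y ++ take (a - B) v) =
      \sum_j (\sum_b s0 b * g b j y) * h j (take (a - B) v).
    rewrite /p /comb; under eq_bigr => b _ do rewrite ghE mulr_sumr.
    rewrite exchange_big /=; apply: eq_bigr => j _.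
    by rewrite mulr_suml; apply: eq_bigr => b _; rewrite mulrA.
  rewrite mulr_suml; apply: eq_bigr => j _; rewrite (bigD1 i) //= eqxx mulr1.
  rewrite [X in _ + X]big1 ?addr0 ?mulrA // => i' /negPf.
  by rewrite eq_sym => ->; rewrite mulr0 mul0r.
- move=> a lt_a; have [le_aB|lt_Ba] := leqP a B.
    have [g [h gh]] := pPhi a le_aB.
    have le_m : (sp * q ^ (a %/ D) <= sp * q ^ k)%N.
      by rewrite leq_pmul2l // leq_pexp2l ?(ltnW lt_1q) // le_div.
    apply: (precut_leq le_m).
    exists (fun i j y => (\sum_b s0 b * g b j (take (B - a) y)) *
       p (t i) (drop (B - a) y)), h.
    move=> i y v sv sy; rewrite -{1}(cat_take_drop (B - a) y) catA.
    have s1 : size (take (B - a) y) = (B - a)%N by rewrite size_takel //; lia.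
    have s2 : size (drop (B - a) y) = B by rewrite size_drop; lia.
    rewrite tens2 ?size_cat ?sv ?s1 //; last lia.
    have ghE b : Phi b (v ++ take (B - a) y) =
        \sum_j g b j (take (B - a) y) * h j v by apply: gh => //; lia.
    rewrite {1}/p /comb; under eq_bigr => b _ do rewrite ghE mulr_sumr.
    rewrite exchange_big /= mulr_suml; apply: eq_bigr => j _.
    rewrite [RHS]mulrAC; congr (_ * _).
    by rewrite mulr_suml; apply: eq_bigr => b _; rewrite mulrA.
  have le_b : (a - B <= B)%N by lia.
  have [g [h gh]] := pPhi (a - B)%N le_b.
  have le_m : (sp * q ^ ((a - B) %/ D) <= sp * q ^ k)%N.
    by rewrite leq_pmul2l // leq_pexp2l ?(ltnW lt_1q) // le_div.
  apply: (precut_leq le_m).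
  exists (fun i j y => \sum_b t i b * g b j y).
  exists (fun j v => p s0 (take B v) * h j (drop B v)) => i y v sv sy.
  have s1 : size (take B v) = B by rewrite size_takel // sv; lia.
  have s2 : size (drop B v) = (a - B)%N by rewrite size_drop sv; lia.
  rewrite -{1}(cat_take_drop B v) -catA tens2 ?size_cat ?s2 //; last lia.
  have ghE b : Phi b (drop B v ++ y) = \sum_j g b j y * h j (drop B v).
    by apply: gh => //; lia.
  rewrite /p /comb [X in _ * X](_ : _ =
    \sum_j (\sum_b t i b * g b j y) * h j (drop B v)); last first.
    under eq_bigr => b _ do rewrite ghE mulr_sumr.
    rewrite exchange_big /=; apply: eq_bigr => j _.
    by rewrite mulr_suml; apply: eq_bigr => b _; rewrite mulrA.
  by rewrite mulr_sumr; apply: eq_bigr => j _; rewrite mulrCA.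
Qed.

End Stages.

(** * Induction over the dyadic ranges of degrees *)

Section Induction.
Local Open Scope ring_scope.
Variables (K : fieldType) (xi : nat) (F : 'I_xi -> seq 'I_2 -> K).
Variables (d : 'I_xi -> nat) (r e : nat -> nat).
Local Open Scope nat_scope.
Hypotheses (hd : forall j, 1 < d j)
  (hr : forall i, r i = #|[set j : 'I_xi | 2 ^ i < d j <= 2 ^ i.+1]|)
  (hgap : forall n j,
     ~~ [&& 2 ^ n.+2 + 2 ^ n.+1 + 2 ^ n < 4 * d j
          & d j < 2 ^ n.+1 + 2 ^ n])
  (he : forall n, r n != 0 -> 1 <= e n <= n - 1)
  (hS : forall n n', r n != 0 -> r n' != 0 -> n != n' ->
     forall k, ~ (n - 1 - e n <= k <= n - 1 /\ n' - 1 - e n' <= k <= n' - 1))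
  (hineq : forall n, r n != 0 ->
     r n * 2 ^ (3 * n + 4) * \prod_(k < n | r k != 0) 2 ^ (2 ^ (e k + 2))
       <= 2 ^ (2 ^ (e n - 1))).

Lemma stage_init : @stage K 'I_2 1 2 1 1 (fun _ _ => False).
Proof.
exists (fun i w => (w == [:: i])%:R%R), (fun i => [:: i]); split=> //.
- by move=> i j; rewrite eqseq_cons andbT eq_sym.
- move=> [|//] _; exists (fun i _ y => (y == [:: i])%:R%R), (fun _ _ => 1%R).
  by move=> i y v /size0nil -> _; rewrite cats0 big_ord1 mulr1.
- move=> [|//] _; exists (fun i _ y => (y == [:: i])%:R%R), (fun _ _ => 1%R).
  by move=> i y v /size0nil -> _; rewrite big_ord1 mulr1.
Qed.

(** The gap at [n] excludes degrees between 7/4 and 3 times [2 ^ n], the gap at [n - 1] those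
    between 7/8 and 3/2 times [2 ^ n]. For [n = 0] the only degree would be 2, which lies in the gap
    at 0. *)
Lemma degree_range n j : 2 ^ n < d j <= 2 ^ n.+1 ->
  3 * 2 ^ n <= 2 * d j /\ 4 * d j <= 7 * 2 ^ n.
Proof.
case/andP=> lt_d le_d; have := hgap n j; rewrite !expnS.
move: lt_d le_d; rewrite expnS; case: n => [|n].
  by rewrite expn0 => lt_d le_d; rewrite negb_and -!leqNgt; lia.
have := hgap n j; rewrite !expnS; move: (2 ^ n) => x.
by rewrite !negb_and -!leqNgt; lia.
Qed.

Definition relations_upto n (d' : nat) (F' : seq 'I_2 -> K) : Prop :=
  exists j, [/\ d j <= 2 ^ n, d' = d j & F' = F j].

(** Each [k] with [r k != 0] multiplies [ss * sp] by at most 2 in [stage_power] and by [2 * N ^ 2]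
    in [stage_step], where [N = 2 ^ (2 ^ (e k + 1))]; this is the factor in the product. *)
Definition reached n : Prop := exists m D q ss sp,
  [/\ stage D q ss sp (relations_upto n), 0 < ss, 0 < sp,
      ss * sp <= \prod_(k < n | r k != 0) (4 * 2 ^ (2 ^ (e k + 2)))
    & [/\ D = 1, q = 2 & forall k, k < n -> r k = 0] \/
      [/\ m < n, r m != 0, (forall k, m < k < n -> r k = 0),
          D = 2 ^ m.+1 & q = 4]].

Lemma reached0 : reached 0.
Proof.
exists 0, 1, 2, 1, 1; split=> //; last by left.
- by apply: stage_sub stage_init => // d' F' [j [le_d _ _]]; have := hd j; lia.
- by rewrite big_ord0.
Qed.

(* The blocks are brought to the length where the range S_n starts; two letters
   per block of length 2^s and four per block of length 2^(s+1) are equally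
   good. *)
Lemma reached_start n : reached n -> r n != 0 ->
  exists g ss sp, [/\ 0 < g <= 2,
    stage (g * 2 ^ (n - 1 - e n)) (2 ^ g) ss sp (relations_upto n), 0 < ss, 0 < sp
    & ss * sp <= 2 * \prod_(k < n | r k != 0) (4 * 2 ^ (2 ^ (e k + 2)))].
Proof.
move=> [m [D [q [ss [sp [st ss0 sp0 le_sp cases]]]]]] rn; set s := n - 1 - e n.
have convert k : 0 < k -> 0 < D -> 1 < q -> k * D = 2 ^ s -> exists g ss sp,
    [/\ 0 < g <= 2, stage (g * 2 ^ s) (2 ^ g) ss sp (relations_upto n), 0 < ss, 0 < sp
    & ss * sp <= 2 * \prod_(k < n | r k != 0) (4 * 2 ^ (2 ^ (e k + 2)))].
  move=> k0 D0 q1 kD; exists 1, (ss * 2), sp; split=> //; last first.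
  - by rewrite mulnAC mulnC leq_mul2l le_sp.
  - by rewrite muln_gt0 ss0.
  by rewrite mul1n -kD expn1; apply: stage_power st.
case: cases => [[D1 q2 _]|[lt_mn rm r0 DE q4]].
  by apply: (convert (2 ^ s)); rewrite ?D1 ?q2 ?muln1 ?expn_gt0.
have [e1 e2] := andP (he rn); have [e3 e4] := andP (he rm).
(* Otherwise [m - 1] would belong to both [S_n] and [S_m]. *)
have le_ms : m <= s.
  rewrite leqNgt; apply/negP => lt_sm.
  have ne : n != m by rewrite gtn_eqF.
  by apply: (hS rn rm ne (k := m.-1)); rewrite /s in lt_sm *; split; lia.
have [eq_ms|ne_ms] := eqVneq m s.
  exists 2, ss, sp; split=> //; first by rewrite -eq_ms -expnS -DE -[2 ^ 2]q4.
  by apply: leq_trans le_sp _; rewrite leq_pmull.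
apply: (convert (2 ^ (s - m.+1))); rewrite ?DE ?q4 ?expn_gt0 //.
by rewrite -expnD subnK // ltn_neqAle ne_ms.
Qed.

Lemma prod_factor4 n : \prod_(k < n | r k != 0) (4 * 2 ^ (2 ^ (e k + 2))) <=
  2 ^ (2 * n) * \prod_(k < n | r k != 0) 2 ^ (2 ^ (e k + 2)).
Proof.
rewrite big_split /= leq_mul // prod_nat_const expnM.
by rewrite leq_pexp2l // -[X in _ <= X](card_ord n) max_card.
Qed.

Lemma reachedS n : reached n -> reached n.+1.
Proof.
move=> Rn; have [r0|rn] := eqVneq (r n) 0.
  move: Rn => [m [D [q [ss [sp [st ss0 sp0 le_sp cases]]]]]].
  exists m, D, q, ss, sp; split=> //.
  - apply: stage_sub st => // d' F' [j [le_d -> ->]]; exists j; split=> //.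
    rewrite leqNgt; apply/negP => lt_d.
    move/eqP: (r0); rewrite hr cards_eq0 => /eqP/setP/(_ j).
    by rewrite !inE lt_d le_d.
  - by rewrite big_mkcond big_ord_recr /= r0 /= muln1 -big_mkcond.
  case: cases => [[D1 q2 rk]|[lt_m rm rk DE qE]]; [left|right]; split=> //.
  - by move=> k; rewrite ltnS leq_eqVlt => /predU1P[->|/rk].
  - exact: ltnW.
  - move=> k; rewrite ltnS [k <= n]leq_eqVlt andb_orr => /orP[/andP[_ /eqP->]|].
      by [].
    exact: rk.
have [g [ss [sp [g12 st ss0 sp0 le_sp]]]] := reached_start Rn rn.
have /andP[e1 e2] := he rn; set s := n - 1 - e n in st.
have nE : n = (e n - 1) + 1 + s.+1 by rewrite /s; lia.
have gE : g = 1 \/ g = 2 by lia.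
(* [k] blocks make up the length [2 ^ n], and [(2 ^ g) ^ k] is [2 ^ (2 ^ (e n + 1))] for both values
   of [g]. *)
pose k := if g == 1 then 2 ^ (e n).+1 else 2 ^ e n.
have kE : k * (g * 2 ^ s) = 2 ^ n.
  case: gE => gE; rewrite /k gE /=.
    by rewrite mul1n -expnD; congr (2 ^ _); lia.
  by rewrite -[2 * _]expnS -expnD; congr (2 ^ _); lia.
have qE : (2 ^ g) ^ k = 2 ^ (2 ^ (e n).+1).
  by rewrite -expnM; case: gE => gE; rewrite /k gE /= ?mul1n // -expnS.
pose J := {j : 'I_xi | 2 ^ n < d j <= 2 ^ n.+1}.
have cJ : #|{: J}| = r n by rewrite card_sig hr cardsE.
set E := 2 ^ (e n - 1).
have EE : 2 ^ (e n).+1 = 4 * E.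
  by rewrite -[4]/(2 ^ 2) -expnD; congr (2 ^ _); lia.
have BE : 2 ^ n = 4 * E * 2 ^ s by rewrite -EE -expnD; congr (2 ^ _); lia.
(* The family has [2 ^ (4 * E)] members on words of length [2 ^ n = 4 * E * 2 ^ s]; cuts of total
   length at most three quarters of that contribute at most [2 ^ (3 * E)]. *)
have := @stage_step K 'I_2 (g * 2 ^ s) (2 ^ g) ss sp (relations_upto n) k J
  (fun j => d (val j)) (fun j => F (val j)) (ss * sp * 2 ^ (3 * E)).
rewrite kE qE => /(_ _ _ _ ss0 sp0 _ _ _ _ st) st'.
exists n, (2 * 2 ^ n), 4, (2 * (ss * 2 ^ 2 ^ (e n).+1)), (sp * 2 ^ 2 ^ (e n).+1).
split.
- apply: stage_sub (st' _ _ _ _ _ _ _) => //.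
  + move=> d' F' [j [le_d -> ->]]; have [le_d'|lt_d] := leqP (d j) (2 ^ n).
      by left; exists j.
    have jP : 2 ^ n < d j <= 2 ^ n.+1 by rewrite lt_d.
    by right; exists (exist _ j jP).
  + by rewrite muln_gt0 expn_gt0; case: gE => ->.
  + by case: gE => ->.
  + by rewrite /k; case: ifP; rewrite expn_gt0.
  + by move=> [j jP] /=; have [] := degree_range jP.
  + by move=> [j jP] /=; have [] := degree_range jP.
  + move=> a b le_ab; rewrite mulnACA leq_mul2l -!expnM -expnD leq_exp2l //.
    apply/orP; right; have s0 : 0 < 2 ^ s by rewrite expn_gt0.
    have h1 := leq_trunc_div a (g * 2 ^ s).
    have h2 := leq_trunc_div b (g * 2 ^ s).
    move: h1 h2 le_ab; rewrite BE; move: (a %/ _) (b %/ _) => x y.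
    move: (2 ^ s) s0 => z z0.
    move=> h1 h2 le_ab; rewrite -(leq_pmul2r z0); nia.
  + rewrite cJ EE; have := hineq rn; rewrite -/E => hn.
    have := leq_trans le_sp (leq_mul (leqnn 2) (prod_factor4 n)).
    move: hn; set X := \prod_(_ < n | _) 2 ^ _ => hn le_X.
    have e16 : 2 ^ (4 * E) = 2 ^ E * 2 ^ (3 * E) by rewrite -expnD; congr (2 ^ _); lia.
    have E0 : 0 < E by rewrite expn_gt0.
    have N16 : 16 <= 2 ^ (4 * E) by rewrite -[16]/(2 ^ 4) leq_exp2l //; lia.
    (* By [hineq] the equations number at most 6/16 of the dimension [2 ^ (4 * E)]; as this
       dimension is at least 16, four solutions are left. *)
    have le1 : 16 * (r n * (2 ^ n * (3 * (ss * sp * 2 ^ (3 * E))))) <=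
               6 * 2 ^ (4 * E).
      apply: (@leq_trans (6 * (r n * 2 ^ (3 * n + 4) * X) * 2 ^ (3 * E))).
        rewrite expnD -[2 ^ 4]/16 (_ : 3 * n = n + 2 * n); last lia.
        rewrite expnD; move: le_X; move: (2 ^ n) (2 ^ (2 * n)) (2 ^ (3 * E)) => u v w.
        move=> le_X; rewrite (_ : 16 * _ = (r n * u * w * 48) * (ss * sp)); last by ring.
        rewrite (_ : 6 * _ * w = (r n * u * w * 48) * (2 * (v * X))); last by ring.
        by rewrite leq_mul2l le_X orbT.
      by rewrite e16 [X in _ <= X]mulnA leq_mul2r leq_mul2l hn !orbT.
    by move: le1 N16; lia.
- by rewrite !muln_gt0 ss0 expn_gt0.
- by rewrite muln_gt0 sp0 expn_gt0.
- rewrite big_mkcond big_ord_recr /= rn -big_mkcond /=.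
  rewrite (_ : 2 ^ (e n + 2) = 2 ^ (e n).+1 + 2 ^ (e n).+1); last first.
    by rewrite addnn -mul2n -expnS addn2.
  rewrite expnD; move: le_sp; set X := \prod_(_ < n | _) _; set N := 2 ^ 2 ^ _ => le_sp.
  rewrite (_ : _ * _ = (2 * N * N) * (ss * sp)); last by ring.
  rewrite (_ : X * _ = (2 * N * N) * (2 * X)); last by ring.
  by rewrite leq_mul2l le_sp orbT.
- right; split=> //; last by rewrite expnS.
  by move=> k' /andP[lt_nk]; rewrite ltnS leqNgt lt_nk.
Qed.

Lemma reached_all n : reached n.
Proof. by elim: n => [|n IH]; [apply: reached0|apply: reachedS]. Qed.

Lemma stage_final : exists D ss sp, 0 < D /\
  stage D 2 ss sp (fun d' F' => exists j, d' = d j /\ F' = F j).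
Proof.
have [m [D [q [ss [sp [st _ _ _ cases]]]]]] := reached_all (\max_j d j).
have [D0 q1] : 0 < D /\ 1 < q.
  by case: cases => [[-> -> _]|[_ _ _ -> ->]]; rewrite ?expn_gt0.
exists D, (ss * 2), sp; split=> //; rewrite -[D]mul1n.
(* The power with [k = 1] just keeps two functionals of the family. *)
apply: (stage_power D0 q1 (ltn0Sn 0)).
apply: (stage_sub (leqnn ss) (leqnn sp) _ st) => d' F' [j [-> ->]].
by exists j; split=> //; apply: leq_trans (leq_bigmax j) (ltnW (ltn_expl _ _)).
Qed.

End Induction.

(** * Linear functionals on the free algebra *)

Section LinearExtension.
Local Open Scope ring_scope.
Variables (K : fieldType) (n : nat).
Local Notation word := (seq 'I_n).
Local Notation A := (free_alg K n).

Definition wordm (w : word) : A := << FMonom w >>.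

Lemma wordm_nil : wordm [::] = 1.
Proof.
apply/malgP => k; rewrite [RHS]mcoeff1 [LHS]mcoeffU1 eq_sym !fmP.
by rewrite -[mone]fmK fm1.
Qed.

Lemma wordmM u v : wordm u * wordm v = wordm (u ++ v).
Proof.
rewrite /wordm malgM_def fgmulUU mulr1; congr << _ >>; apply/eqP.
by rewrite fmP fmM.
Qed.

Section Ext.
Variable V : lmodType K.
Implicit Types (f g : word -> V) (a b : A).

Definition lext f a : V := \sum_(m <- msupp a) a@_m *: f m.

Lemma lextEw (D : {fset {fmonom 'I_n}}) f a : (msupp a `<=` D)%fset ->
  lext f a = \sum_(m <- D) a@_m *: f m.
Proof.
move=> le_D; apply: big_fset_incl => // m _ /mcoeff_outdom ->.
by rewrite scale0r.
Qed.

Lemma lext_is_linear f : linear (lext f).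
Proof.
move=> k a b; set D := (msupp (k *: a + b) `|` (msupp a `|` msupp b))%fset.
rewrite (lextEw (D := D)) ?fsubsetUl // (lextEw (D := D) _ (a := a)); last first.
  by rewrite /D fsetUCA fsubsetUl.
rewrite (lextEw (D := D) _ (a := b)); last by rewrite /D fsetUA fsubsetUr.
rewrite scaler_sumr -big_split; apply: eq_bigr => m _ /=.
by rewrite mcoeffD mcoeffZ scalerDl scalerA.
Qed.

HB.instance Definition _ f := GRing.isLinear.Build K A V _ (lext f)
  (lext_is_linear f).

Lemma lext_wordm f w : lext f (wordm w) = f w.
Proof.
by rewrite /lext /wordm msuppU1 big_seq_fset1 mcoeffUU scale1r.
Qed.

Lemma eq_lext f g a : (forall m, m \in msupp a -> f m = g m) ->
  lext f a = lext g a.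
Proof. by move=> fg; apply: eq_big_seq => m /fg ->. Qed.

Lemma lext_comp (U : lmodType K) (h : {linear V -> U}) f a :
  h (lext f a) = \sum_(m <- msupp a) a@_m *: h (f m).
Proof. by rewrite linear_sum; apply: eq_bigr => m _; rewrite linearZ. Qed.

End Ext.

Lemma wordm_sum (a : A) : a = lext wordm a.
Proof.
rewrite {1}[a]monalgE; apply: eq_bigr => m _; rewrite /wordm fmK.
apply/malgP => k; rewrite [RHS]mcoeffZ [LHS]mcoeffU [in RHS]mcoeffU.
by case: eqP => _; rewrite ?mulr1 ?mulr0.
Qed.

Lemma lextM (V : lmodType K) (f : word -> V) (a b : A) :
  lext f (a * b) = lext (fun u => lext (fun v => f (u ++ v)) b) a.
Proof.
rewrite {1}(wordm_sum a) mulr_suml linear_sum; apply: eq_bigr => m _.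
rewrite -scalerAl linearZ; congr (_ *: _).
rewrite {1}(wordm_sum b) mulr_sumr linear_sum; apply: eq_bigr => m' _.
by rewrite -scalerAr linearZ /= wordmM lext_wordm.
Qed.

Lemma free_evalE (R : algType K) (b : 'I_n -> R) (p : A) :
  free_eval b p = lext (fun w => \prod_(i <- w) b i) p.
Proof.
by rewrite /free_eval mmapE; apply: eq_bigr => m _; rewrite mulr_algl.
Qed.

Lemma free_evalM (R : algType K) (b : 'I_n -> R) (p q : A) :
  free_eval b (p * q) = free_eval b p * free_eval b q.
Proof.
rewrite !free_evalE lextM /lext mulr_suml; apply: eq_bigr => m _.
rewrite -scalerAl mulr_sumr; congr (_ *: _); apply: eq_bigr => m' _.
by rewrite big_cat scalerAr.
Qed.

Lemma homogeneous_sub k : subspace (@homogeneous K n k).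
Proof.
split=> [m|c p q hp hq m]; first by rewrite msupp0.
move/(fsubsetP (msuppD_le _ _)); rewrite inE => /orP[|/hq //].
by move/(fsubsetP (msuppZ_le _ _))/hp.
Qed.

Lemma homogeneous_wordm w : homogeneous (size w) (wordm w).
Proof. by move=> m; rewrite msuppU1 inE => /eqP ->. Qed.

Lemma homogeneousM k l (p q : A) :
  homogeneous k p -> homogeneous l q -> homogeneous (k + l) (p * q).
Proof.
move=> hp hq m /(fsubsetP (msuppM_incl p q)).
case/imfset2P=> m1 /hp h1 [m2 /hq h2 ->].
by rewrite fdegM h1 h2.
Qed.

Lemma homogeneous_sum k (I : Type) (r : seq I) (P : pred I) (F : I -> A) :
  (forall i, P i -> homogeneous k (F i)) ->
  homogeneous k (\sum_(i <- r | P i) F i).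
Proof.
have [h0 hD] := homogeneous_sub k.
move=> hF; apply: big_ind => // x y hx hy.
by rewrite -[x]scale1r; apply: hD.
Qed.

Lemma homogeneousZ k c (p : A) : homogeneous k p -> homogeneous k (c *: p).
Proof.
have [h0 hD] := homogeneous_sub k => hp.
by rewrite -[_ *: _]addr0; apply: hD.
Qed.

(** The weight is a parameter: [size] gives the degree, and [size c * D] gives the degree after
    substituting words of length [D] for the variables. *)
Definition wcomp (wt : word -> nat) k (a : A) : A :=
  \sum_(m <- msupp a | wt m == k) a@_m *: wordm m.

Lemma wcomp_sum wt (a : A) :
  exists N0, forall N, (N0 <= N)%N -> a = \sum_(k < N) wcomp wt k a.
Proof.
exists (\max_(m <- msupp a) (wt m).+1) => N le_N.
under eq_bigr => k _ do rewrite /wcomp big_mkcond.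
rewrite exchange_big /= {1}(wordm_sum a); apply: eq_big_seq => m sm.
have lt_N : (wt m < N)%N by apply: leq_trans le_N; apply: leq_bigmax_seq.
rewrite (bigD1 (Ordinal lt_N)) //= eqxx big1 ?addr0 // => k.
by rewrite -val_eqE eq_sym /= => /negPf ->.
Qed.

Lemma homogeneous_wcomp k a : homogeneous k (wcomp size k a).
Proof.
apply: homogeneous_sum => m /eqP <-.
exact/homogeneousZ/homogeneous_wordm.
Qed.

Lemma lext_delta c (a : A) :
  lext (fun u => (u == c)%:R : K^o) a = a@_(FMonom c).
Proof.
rewrite /lext; case: (boolP (FMonom c \in msupp a)) => [ca|].
  rewrite (big_fsetD1 _ ca) /= eqxx big_seq big1 => [|c'].
    by rewrite addr0 -[LHS]/(_ * _) mulr1.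
  by rewrite !inE fmP /= => /andP[/negPf-> _]; rewrite scaler0.
move=> ca; rewrite (mcoeff_outdom ca) big_seq big1 // => c' c'a.
case: eqP => [e|_]; last by rewrite scaler0.
by rewrite -e fmK c'a in ca.
Qed.

Lemma homogeneous_tuple k (a : A) : homogeneous k a ->
  forall V : lmodType K, forall f : word -> V,
  lext f a = \sum_(w : k.-tuple 'I_n) a@_(FMonom w) *: f w.
Proof.
move=> ha V f; rewrite /lext.
rewrite (perm_big (filter (fun m => m \in msupp a)
   (map (fun w : k.-tuple 'I_n => FMonom w) (index_enum _)))) /=; last first.
  apply: uniq_perm; first exact: fset_uniq.
    rewrite filter_uniq // map_inj_uniq ?index_enum_uniq // => w w' [e].
    exact: val_inj.
  move=> m; rewrite mem_filter; case ma : (m \in msupp a) => //=.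
  have sm : size m == k by apply/eqP; apply: ha.
  apply/esym/mapP; exists (Tuple sm); first exact: mem_index_enum.
  by rewrite fmK.
rewrite big_filter big_map [RHS]big_mkcond [LHS]big_mkcond.
apply: eq_bigr => w _ /=; case: ifP => // /negbT/mcoeff_outdom ->.
by rewrite scale0r.
Qed.

End LinearExtension.

Section Annihilator.
Local Open Scope ring_scope.
Variables (K : fieldType) (n : nat).
Local Notation word := (seq 'I_n).
Local Notation A := (free_alg K n).

Lemma lext_exchange (f : word -> word -> K^o) (a b : A) :
  lext (fun u => lext (f u) b) a = lext (fun v => lext (f ^~ v) a) b.
Proof.
rewrite /lext; under eq_bigr => m _ do rewrite scaler_sumr.
rewrite exchange_big; apply: eq_bigr => m' _; rewrite scaler_sumr.
by apply: eq_bigr => m _; rewrite !scalerA mulrC.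
Qed.

(** The largest two-sided ideal on which all [psi x] vanish. *)
Definition ann (X : Type) (psi : X -> word -> K) (a : A) : Prop :=
  forall x u v, lext (fun m => psi x (u ++ m ++ v) : K^o) a = 0.

Lemma ann_ideal (X : Type) (psi : X -> word -> K) : ideal (ann psi).
Proof.
have sub : subspace (ann psi).
  split=> [x u v|c a b ha hb x u v]; first by rewrite linear0.
  by rewrite linearP /= ha hb scaler0 addr0.
split; split=> //.
- move=> s a _ ha x u v; rewrite lextM.
  rewrite (eq_lext (g := fun _ => 0)) => [|m _].
    by rewrite /lext big1 // => m _; rewrite scaler0.
  rewrite -[RHS](ha x (u ++ m) v); apply: eq_lext => m' _.
  by rewrite -!catA.
- move=> s a ha x u v; rewrite lextM lext_exchange.
  rewrite (eq_lext (g := fun _ => 0)) => [|m _].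
    by rewrite /lext big1 // => m _; rewrite scaler0.
  rewrite -[RHS](ha x u (m ++ v)); apply: eq_lext => m' _.
  by rewrite -!catA.
Qed.

Lemma ann_homogeneous k (X : Type) (psi : X -> word -> K) (a : A) :
  homogeneous k a ->
  (forall x, kills k (fun w => a@_(FMonom w)) (psi x)) -> ann psi a.
Proof. by move=> ha ka x u v; rewrite (homogeneous_tuple ha); apply: ka. Qed.

End Annihilator.

(** * A free subalgebra generated by two monomials *)

Section FreeSubalgebra.
Local Open Scope ring_scope.
Variables (K : fieldType) (J : Type) (f : J -> free_alg K 2) (R : algType K).
Variables (pi : {lrmorphism free_alg K 2 -> R}).
Hypothesis hpi : is_quotient (generated_ideal f) pi.
Variables (D : nat) (P : 'I_2 -> seq 'I_2 -> K) (m : 'I_2 -> seq 'I_2).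
Hypotheses (D_gt0 : (0 < D)%N) (sm : forall i, size (m i) = D).
Hypothesis Pm : forall i j, P i (m j) = (i == j)%:R.
Hypothesis Pf : forall j,
  ann (fun c : seq 'I_2 => tens D (map P c)) (f j).
Local Notation A := (free_alg K 2).

Lemma ann_pi a : pi a = 0 -> ann (fun c : seq 'I_2 => tens D (map P c)) a.
Proof. by case: hpi => _ h /h; apply=> //; apply: ann_ideal. Qed.

Lemma pi_eq0_lext a (c : seq 'I_2) : pi a = 0 ->
  lext (tens D (map P c) : seq 'I_2 -> K^o) a = 0.
Proof.
move/ann_pi/(_ c [::] [::]) => <-.
by apply: eq_lext => w _; rewrite cats0.
Qed.

Let sm' i : size (m i) == D. Proof. exact/eqP. Qed.
Let w i : D.-tuple 'I_2 := Tuple (sm' i).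
Let b i : R := pi (monomial K (w i)).

Lemma prod_b c : \prod_(i <- c) b i = pi (wordm K (flatten (map m c))).
Proof.
elim: c => [|i c IH]; first by rewrite big_nil /= wordm_nil rmorph1.
by rewrite big_cons IH /= -wordmM rmorphM.
Qed.

Let img (p : A) : A := lext (fun c => wordm K (flatten (map m c))) p.

Lemma free_eval_pi p : free_eval b p = pi (img p).
Proof.
by rewrite free_evalE lext_comp; apply: eq_bigr => c _; rewrite prod_b.
Qed.

(** The tensor product indexed by [c] reads off the coefficient of [c] after substitution of the
    words [m i]. As it vanishes on the ideal of relations, evaluation at the two words is injective
    in the quotient. *)
Lemma lext_img c p :
  lext (tens D (map P c) : seq 'I_2 -> K^o) (img p) = p@_(FMonom c).
Proof.
rewrite /img lext_comp -[RHS]lext_delta; apply: eq_bigr => c' _.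
by rewrite /= lext_wordm (tens_dual D_gt0 sm Pm) eq_sym.
Qed.

Lemma free_subalgebra : exists (w : 'I_2 -> D.-tuple 'I_2) (S : R -> Prop),
  [/\ subalgebra S,
      graded_subspace (fun n => direct_image pi (homogeneous n)) S
    & freely_generated S (fun i => pi (monomial K (w i)))].
Proof.
exists w, (fun x => exists p, x = free_eval b p).
have sub : subspace (fun x => exists p, x = free_eval b p).
  split; first by exists 0; rewrite free_evalE linear0.
  move=> c _ _ [p ->] [q ->]; exists (c *: p + q).
  by rewrite !free_evalE linearP.
split; first split=> //.
- by exists 1; rewrite free_evalE -wordm_nil lext_wordm big_nil.
- by move=> _ _ [p ->] [q ->]; exists (p * q); rewrite free_evalM.
- split=> // _ [p ->]; pose wt (c : seq 'I_2) := (size c * D)%N.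
  have [N pE] := wcomp_sum wt p.
  exists N, (fun k => free_eval b (wcomp wt k p)); split=> [k|].
    split; last by exists (wcomp wt k p).
    exists (img (wcomp wt k p)); last exact: free_eval_pi.
    rewrite /img /wcomp linear_sum; apply: homogeneous_sum => c /eqP <-.
    rewrite linearZ /= lext_wordm; apply: homogeneousZ.
    by rewrite /wt -(size_dual sm); apply: homogeneous_wordm.
  rewrite {1}(pE N (leqnn N)) !free_evalE linear_sum.
  by apply: eq_bigr => k _; rewrite free_evalE.
- split=> // p q; rewrite !free_eval_pi => /eqP; rewrite -subr_eq0 -rmorphB.
  move/eqP => pq0; apply/malgP => c; apply/eqP; rewrite -subr_eq0 -(fmK c).
  move: pq0 (lext_img c p) (lext_img c q).
  by move: (img p) (img q) => x y /(pi_eq0_lext c) + <- <-; rewrite linearB => /eqP.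
Qed.

(* A quasi-inverse of the word m 0 would have to be the infinite sum of its
   powers: the k-th power of P 0 takes the value 1 on it for all k > 0. *)
Lemma wordm_not_quasiregular a : augmentation a ->
  pi (wordm K (m ord0)) <> pi a - pi a * pi (wordm K (m ord0)).
Proof.
move=> ha /eqP; rewrite -subr_eq0 -rmorphM -!rmorphB => /eqP pi0.
pose t k : seq 'I_2 -> K^o := tens D (map P (nseq k ord0)).
have t0 : lext (t 0%N) a = 0.
  have one : mone = FMonom [::] :> {fmonom 'I_2}.
    by apply/eqP; rewrite fmP fm1.
  rewrite -[RHS]ha one -lext_delta; apply: eq_lext => c _; rewrite /t.
  by case: eqP => [->|/eqP nc]; rewrite ?tens_nil ?tens_size // mul0n size_eq0.
(* Apply [t k.+1] to [m 0 - (a - a * m 0)], which lies in the kernel; splitting off the last block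
   turns the value on [a * m 0] into [t k] on [a]. *)
have tS k : lext (t k.+1) a = lext (t k) a + (k == 0%N)%:R.
  have := pi_eq0_lext (nseq k.+1 ord0) pi0; rewrite -/(t _) !linearB /=.
  have -> : lext (t k.+1) (wordm K (m ord0)) = (k == 0%N)%:R.
    rewrite lext_wordm -[m ord0]cats0 -[m _ ++ _]/(flatten (map m [:: ord0])).
    by rewrite /t (tens_dual D_gt0 sm Pm) /= eqseq_cons eqxx -size_eq0 size_nseq.
  have -> : lext (t k.+1) (a * wordm K (m ord0)) = lext (t k) a.
    rewrite lextM; apply: eq_lext => u _; rewrite lext_wordm /t.
    have -> : nseq k.+1 ord0 = nseq k (ord0 : 'I_2) ++ [:: ord0].
      by elim: (k) => //= l ->.
    rewrite map_cat; have [su|su] := eqVneq (size u) (k * D)%N.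
      by rewrite tens_cat ?size_map ?size_nseq // tens1 // Pm mulr1.
    rewrite !tens_size ?size_cat ?size_map ?size_nseq //= sm.
    by rewrite addn1 mulSn addnC eqn_add2l.
  by move/eqP; rewrite opprK addrCA addrC subr_eq0 => /eqP <-; rewrite addrC.
have t1 k : lext (t k.+1) a = 1.
  by elim: k => [|k IH]; rewrite tS ?t0 ?add0r // IH addr0.
have := t1 (\max_(c <- msupp a) size c); set M := \max_(c <- _) _.
rewrite /lext big_seq big1 => [/eqP|c ca]; first by rewrite eq_sym oner_eq0.
rewrite /t tens_size ?scaler0 // size_map size_nseq.
have : (size c <= M)%N by rewrite /M; apply: leq_bigmax_seq.
by rewrite -ltnS neq_ltn => /leq_trans -> //; rewrite leq_pmulr.
Qed.

End FreeSubalgebra.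

(** * Maximal left ideals and quotient algebras *)

Section MaximalLeftIdeal.
Local Open Scope ring_scope.
Variables (K : fieldType) (R : algType K) (S : R -> Prop) (e : R).
Hypotheses (subS : subspace S) (mulS : forall s t, S s -> S t -> S (s * t)).
Hypotheses (Se : S e) (qe : forall s, S s -> e <> s - s * e).

(** The elements [s - s * e] form a left ideal modulo which [e] is a right unit; by [qe] it omits
    [e]. A left ideal containing it and [e] is all of [S], as [s = (s - s * e) + s * e]; hence one
    that is maximal among those omitting [e] is a maximal left ideal. *)
Lemma exists_maximal_modular :
  exists L, maximal_modular_left_ideal S L /\ ~ L e.
Proof.
pose good (L : set R) :=
  [/\ left_ideal_in S L, forall s, S s -> L (s - s * e) & ~ L e].
pose L0 : set R := fun x => exists2 s, S s & x = s - s * e.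
have [S0 SD] := subS.
have good0 : good L0.
  split=> [|s Ss|[s /qe //]]; last by exists s.
  split=> [|_ [s Ss ->]|s _ Ss [t St ->]].
  - split=> [|c _ _ [s Ss ->] [t St ->]].
      by exists 0; rewrite ?mul0r ?subrr.
    exists (c *: s + t); first exact: SD.
    by rewrite mulrDl -scalerAl scalerBr addrACA opprD.
  - rewrite -scaleN1r addrC; apply: SD => //; exact: mulS.
  - by exists (s * t); rewrite ?mulrBr ?mulrA //; apply: mulS.
have [|A [PA maxA]] := @Zorn_bigcup R (fun L => (forall x, ~ L x) \/ good L).
  move=> F PF totF; have [[x [X FX Xx]]|no] :=
    pselect (exists x, (\bigcup_(X in F) X)%classic x); last first.
    by left=> x Ux; apply: no; exists x.
  have goodF Y y : F Y -> Y y -> good Y by move=> /PF[/(_ y)|].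
  have [[[X0 XD] XS XM] Xq Xe] := goodF X x FX Xx.
  right; split=> [|s Ss|[Y FY Ye]]; last by have [_ _ /(_ Ye)] := goodF _ _ FY Ye.
    split=> [|y [Y FY Yy]|s y Ss [Y FY Yy]].
    - split=> [|c y z [Y FY Yy] [Z FZ Zz]]; first by exists X.
      have [[[_ YD] _ _] _ _] := goodF _ _ FY Yy.
      have [[[_ ZD] _ _] _ _] := goodF _ _ FZ Zz.
      by have [/(_ y Yy) Zy|/(_ z Zz) Yz] := totF _ _ FY FZ;
        [exists Z|exists Y] => //; [apply: ZD|apply: YD].
    - by have [[_ YS _] _ _] := goodF _ _ FY Yy; apply: YS.
    - by have [[_ _ YM] _ _] := goodF _ _ FY Yy; exists Y => //; apply: YM.
  by exists X => //; apply: Xq.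
have {PA} goodA : good A.
  case: PA => // A0; have ltA : (A `<` L0)%classic.
    split=> [x /A0 //|H]; apply: (A0 0); apply: H.
    by have [[[]]] := good0.
  by case: (maxA L0 ltA); right.
exists A; have [idA qA nAe] := goodA; split=> //.
split=> //; [by exists e|by exists e|move=> L' idL' AL' [x [L'x nAx]] s Ss].
have L'e : L' e.
  apply: contrapT => nL'e; apply: (maxA L').
    by split=> [//|H]; apply/nAx/H.
  by right; split=> // t St; apply/AL'/qA.
have [[L'0 L'D] L'S L'M] := idL'.
rewrite -[s](subrK (s * e)) -[s - _]scale1r.
by apply: L'D; [apply/AL'/qA|apply: L'M].
Qed.

Lemma not_jacobson_radical : ~ is_jacobson_radical S.
Proof.
have [L [maxL nLe]] := exists_maximal_modular.
by move=> /(_ e)[_ /(_ Se)[_ /(_ L maxL)]].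
Qed.

End MaximalLeftIdeal.

Section QuotientAlgebra.
Local Open Scope ring_scope.
Local Open Scope quotient_scope.
Variables (K : fieldType) (R : algType K) (J : R -> Prop).
Hypotheses (idJ : ideal J) (J1 : ~ J 1).

Definition quot_pred : {pred R} := fun x => `[< J x >].

Let JD x y : J x -> J y -> J (x + y).
Proof.
by case: idJ => [[[_ h] _ _] _] Jx Jy; rewrite -[x]scale1r; apply: h.
Qed.
Let JZ c x : J x -> J (c *: x).
Proof.
by case: idJ => [[[J0 h] _ _] _] Jx; rewrite -[_ *: _]addr0; apply: h.
Qed.
Let JMl x y : J y -> J (x * y).
Proof. by case: idJ => [[_ _ JM] _]; apply: JM. Qed.
Let JMr x y : J x -> J (x * y).
Proof. by case: idJ => [_ [_ JM]]; apply: JM. Qed.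

Fact quot_pred_closed : zmod_closed quot_pred.
Proof.
split=> [|x y /asboolP Jx /asboolP Jy]; apply/asboolP.
  by case: idJ => [[[]]].
by apply: JD => //; rewrite -scaleN1r; apply: JZ.
Qed.

HB.instance Definition _ := GRing.isZmodClosed.Build R quot_pred
  quot_pred_closed.

Definition quot_alg : Type := Quotient.quot quot_pred.
HB.instance Definition _ := GRing.Zmodule.on quot_alg.
HB.instance Definition _ := EqQuotient.on quot_alg.
Local Notation Q := quot_alg.

Let piE (x y : R) : \pi_Q x = \pi_Q y <-> J (x - y).
Proof.
split=> [/eqP|Jxy]; first by rewrite -Quotient.idealrBE => /asboolP.
by apply/eqP; rewrite -Quotient.idealrBE; apply/asboolP.
Qed.

Let reprJ (x : R) : J (repr (\pi_Q x) - x).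
Proof. by apply/piE; rewrite reprK. Qed.

Fact quot_mul : {mul : Q -> Q -> Q |
  forall x y, mul (\pi_Q x) (\pi_Q y) = \pi_Q (x * y)}.
Proof.
exists (fun a b => \pi_Q (repr a * repr b)) => x y; apply/piE.
rewrite -(subrK (x * repr (\pi_Q y)) (_ * _)) -mulrBl -addrA -mulrBr.
by apply: JD; [apply/JMr/reprJ|apply/JMl/reprJ].
Qed.

Fact quot_scale : {scale : K -> Q -> Q |
  forall c x, scale c (\pi_Q x) = \pi_Q (c *: x)}.
Proof.
exists (fun c a => \pi_Q (c *: repr a)) => c x.
by apply/piE; rewrite -scalerBr; apply/JZ/reprJ.
Qed.

Let mulq := sval quot_mul.
Let mulqE x y : mulq (\pi_Q x) (\pi_Q y) = \pi_Q (x * y).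
Proof. exact: (svalP quot_mul). Qed.
Let scaleq := sval quot_scale.
Let scaleqE c x : scaleq c (\pi_Q x) = \pi_Q (c *: x).
Proof. exact: (svalP quot_scale). Qed.

Let piD x y : \pi_Q (x + y) = \pi_Q x + \pi_Q y.
Proof. exact: raddfD. Qed.

Let mulqA : associative mulq.
Proof.
by move=> x y z; rewrite -[x]reprK -[y]reprK -[z]reprK !mulqE mulrA.
Qed.
Let mul1q : left_id (\pi_Q 1) mulq.
Proof. by move=> x; rewrite -[x]reprK mulqE mul1r. Qed.
Let mulq1 : right_id (\pi_Q 1) mulq.
Proof. by move=> x; rewrite -[x]reprK mulqE mulr1. Qed.
Let mulqDl : left_distributive mulq +%R.
Proof.
move=> x y z; rewrite -[x]reprK -[y]reprK -[z]reprK.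
by rewrite -(piD (repr x) (repr y)) !mulqE mulrDl piD.
Qed.
Let mulqDr : right_distributive mulq +%R.
Proof.
move=> x y z; rewrite -[x]reprK -[y]reprK -[z]reprK.
by rewrite -(piD (repr y) (repr z)) !mulqE mulrDr piD.
Qed.
Let one_neq0 : \pi_Q 1 != 0.
Proof.
apply/eqP; rewrite -[0](raddf0 \pi_Q) => /piE; by rewrite subr0.
Qed.

Let scaleqA a b v : scaleq a (scaleq b v) = scaleq (a * b) v.
Proof. by rewrite -[v]reprK !scaleqE scalerA. Qed.
Let scale1q : left_id 1 scaleq.
Proof. by move=> x; rewrite -[x]reprK scaleqE scale1r. Qed.
Let scaleqDr : right_distributive scaleq +%R.
Proof.
move=> c x y; rewrite -[x]reprK -[y]reprK.
by rewrite -(piD (repr x) (repr y)) !scaleqE scalerDr piD.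
Qed.
Let scaleqDl v : {morph scaleq^~ v : a b / a + b}.
Proof. by move=> a b; rewrite -[v]reprK !scaleqE scalerDl piD. Qed.
Let scaleqAl a u v : scaleq a (mulq u v) = mulq (scaleq a u) v.
Proof. by rewrite -[u]reprK -[v]reprK !(mulqE, scaleqE) scalerAl. Qed.
Let scaleqAr a u v : scaleq a (mulq u v) = mulq u (scaleq a v).
Proof. by rewrite -[u]reprK -[v]reprK !(mulqE, scaleqE) scalerAr. Qed.

HB.instance Definition _ := GRing.Zmodule_isNzRing.Build Q
  mulqA mul1q mulq1 mulqDl mulqDr one_neq0.
HB.instance Definition _ := GRing.Zmodule_isLmodule.Build K Q
  scaleqA scale1q scaleqDr scaleqDl.
HB.instance Definition _ := GRing.Lmodule_isLalgebra.Build K Q scaleqAl.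
HB.instance Definition _ := GRing.Lalgebra_isAlgebra.Build K Q scaleqAr.

Lemma quotient_algebra : exists (B : algType K) (phi : {lrmorphism R -> B}),
  (forall b, exists x, b = phi x) /\ forall x, phi x = 0 <-> J x.
Proof.
have lin : linear (\pi_Q : R -> Q).
  by move=> c x y; rewrite piD; congr (_ + _); apply/esym/scaleqE.
have mul : monoid_morphism (\pi_Q : R -> Q).
  by split=> // x y; apply/esym/mulqE.
pose L := GRing.isLinear.Build K R Q _ _ lin.
pose M := GRing.isMonoidMorphism.Build R Q _ mul.
pose phi : {lrmorphism R -> Q} := HB.pack (\pi_Q : R -> Q) L M.
exists Q, phi; split=> [b|x]; first by exists (repr b); rewrite /= reprK.
rewrite -[0](raddf0 phi); split=> [/piE|Jx]; first by rewrite subr0.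
by apply/piE; rewrite subr0.
Qed.

End QuotientAlgebra.

(** * Graded algebras *)

Section Independence.
Local Open Scope ring_scope.
Variables (K : fieldType) (B : algType K).
Implicit Types (V W : B -> Prop).

Lemma subspaceD V x y : subspace V -> V x -> V y -> V (x + y).
Proof. by move=> [_ VD] Vx Vy; rewrite -[x]scale1r; apply: VD. Qed.

Lemma subspaceZ V a x : subspace V -> V x -> V (a *: x).
Proof. by move=> [V0 VD] Vx; rewrite -[_ *: _]addr0; apply: VD. Qed.

Lemma subspaceN V x : subspace V -> V x -> V (- x).
Proof. by move=> sV Vx; rewrite -scaleN1r; apply: subspaceZ. Qed.

Lemma subspaceB V x y : subspace V -> V x -> V y -> V (x - y).
Proof. by move=> sV Vx Vy; apply: subspaceD => //; apply: subspaceN. Qed.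

Lemma subspace_sum V (I : Type) (r : seq I) (P : pred I) (F : I -> B) :
  subspace V -> (forall i, P i -> V (F i)) -> V (\sum_(i <- r | P i) F i).
Proof.
move=> sV VF; apply: big_ind => [|x y Vx Vy|//]; first by case: sV.
exact: subspaceD.
Qed.

Definition indep k (v : 'I_k -> B) : Prop :=
  forall a : 'I_k -> K, \sum_i a i *: v i = 0 -> forall i, a i = 0.

Lemma indep_bound V c k (v : 'I_k -> B) :
  dim_le V c -> (forall i, V (v i)) -> indep v -> (k <= c)%N.
Proof.
move=> [b [_ Vb]] Vv iv; rewrite leqNgt; apply/negP => lt_ck.
have /fin_all_exists[a va] i := Vb _ (Vv i).
pose A : 'M[K]_(k, c) := \matrix_(i, j) a i j.
have /rowV0Pn[u uA u0] : kermx A != 0.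
  rewrite -mxrank_eq0 mxrank_ker -lt0n subn_gt0.
  exact: leq_ltn_trans (rank_leq_col A) lt_ck.
case/negP: u0; apply/eqP/rowP => i; rewrite [RHS]mxE.
apply: (iv (fun i => u 0 i)).
under eq_bigr => l _ do rewrite va scaler_sumr.
rewrite exchange_big big1 // => j _.
under eq_bigr => l _ do rewrite scalerA.
rewrite -scaler_suml; move/sub_kermxP/rowP/(_ j): uA; rewrite !mxE => uA.
rewrite (eq_bigr (fun l => u 0 l * A l j)) => [|l _]; last by rewrite mxE.
by rewrite uA scale0r.
Qed.

Definition has_indep V k : Prop :=
  exists2 v : 'I_k -> B, forall i, V (v i) & indep v.

(* The dimension of V, if V lies in a space of dimension at most c. *)
Definition dimn c V : nat := \max_(k < c.+1 | `[< has_indep V k >]) k.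

Lemma dimn_le V c : (dimn c V <= c)%N.
Proof. by apply/bigmax_leqP => k _; rewrite -ltnS. Qed.

Lemma dimn_attained V c : has_indep V (dimn c V).
Proof.
have h0 : `[< has_indep V (ord0 : 'I_c.+1) >].
  by apply/asboolP; exists (fun _ => 0) => [[]|? ? []].
rewrite /dimn.
have c0 : (0 < #|[pred k : 'I_c.+1 | `[< has_indep V k >]]|)%N.
  by apply/card_gt0P; exists ord0.
by have [k /asboolP hk ->] := eq_bigmax_cond (fun k : 'I_c.+1 => k : nat) c0.
Qed.

Lemma dim_le_sub V W c k (v : 'I_k -> B) : (forall x, V x -> W x) ->
  dim_le W c -> (forall i, V (v i)) -> indep v -> (k <= c)%N.
Proof. by move=> VW Wc Vv; apply: (indep_bound Wc) => i; apply: VW. Qed.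

(** An element of [V'] outside [V] would enlarge a maximal independent family of [V]. *)
Lemma dimn_eq_sub W V V' c : dim_le W c -> (forall x, V' x -> W x) ->
  subspace V -> (forall x, V x -> V' x) ->
  (dimn c V' <= dimn c V)%N -> forall x, V' x -> V x.
Proof.
move=> Wc V'W sV VV' le_d x V'x; apply: contrapT => nVx.
have [v Vv iv] := dimn_attained V c; set k := dimn c V in v Vv iv le_d.
pose v' (i : 'I_k.+1) := oapp v x (unlift ord_max i).
have iv' : indep v'.
  move=> a; rewrite big_ord_recr /= {2}/v' unlift_none /= => av.
  have av' : \sum_i a (widen_ord (leqnSn k) i) *: v i + a ord_max *: x = 0.
    rewrite -[RHS]av; congr (_ + _); apply: eq_bigr => i _; rewrite /v'.
    by rewrite (_ : widen_ord _ i = lift ord_max i) ?liftK //;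
      apply: val_inj; rewrite /= /bump leqNgt ltn_ord.
  have ax : a ord_max = 0.
    apply: contrapT => /eqP nz; apply: nVx.
    rewrite -[x](scalerK nz); apply: subspaceZ => //.
    rewrite -[_ *: _](addrK (\sum_i a (widen_ord (leqnSn k) i) *: v i)).
    rewrite addrC [X in _ + X]addrC av' addr0; apply: subspaceN => //.
    by apply: subspace_sum => // i _; apply: subspaceZ.
  move: av'; rewrite ax scale0r addr0 => /iv a0 i.
  have [->//|] := eqVneq i ord_max; rewrite eq_sym => /unlift_some[j -> _].
  rewrite -[RHS](a0 j); congr a.
  by apply: val_inj; rewrite /= /bump leqNgt ltn_ord.
have V'v' i : V' (v' i).
  by rewrite /v'; case: (unlift _ i) => //= j; apply: VV'.
have le_k : (k.+1 <= dimn c V')%N.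
  have le_c : (k.+1 <= c)%N by apply: (dim_le_sub V'W Wc V'v' iv').
  apply: (leq_bigmax_cond (Ordinal (le_c : k.+1 < c.+1)%N)).
  by apply/asboolP; exists v'.
by move: (leq_trans le_k le_d); rewrite ltnn.
Qed.

End Independence.

(** * Stabilization of bounded monotone functions *)

Section Stabilization.
Local Open Scope ring_scope.

Lemma bounded_max (P : nat -> Prop) c : (exists n, P n) ->
  (forall n, P n -> (n <= c)%N) ->
  exists2 n, P n & forall k, P k -> (k <= n)%N.
Proof.
move=> [n0 Pn0] Pc.
have ex : exists n, `[< P n >] by exists n0; apply/asboolP.
have bd n : `[< P n >] -> (n <= c)%N by move=> /asboolP/Pc.
have [n /asboolP Pn max] := ex_maxnP ex bd.
by exists n => // k Pk; apply: max; apply/asboolP.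
Qed.

Lemma fin_bound (I : finType) (P : I -> nat -> Prop) :
  (forall i, exists N, forall k, (N <= k)%N -> P i k) ->
  exists N, forall i k, (N <= k)%N -> P i k.
Proof.
move=> /fin_all_exists[N hN]; exists (\max_i N i) => i k le_k.
by apply: hN; apply: leq_trans le_k; apply: leq_bigmax.
Qed.

Lemma bounded_homo_stable (h : nat -> nat) c : {homo h : i j / (i <= j)%N} ->
  (forall i, (h i <= c)%N) ->
  exists N, forall k, (N <= k)%N -> h k = h N.
Proof.
move=> mono hc; have [||m [N ->] maxm] := @bounded_max (fun m => exists i, m = h i) c.
- by exists (h 0%N), 0%N.
- by move=> m [i ->].
exists N => k le_k; apply/eqP; rewrite eqn_leq; apply/andP.
by split; [apply: maxm; exists k|apply: mono].
Qed.

(** Beyond a point [(i0, k0)] where the maximum is attained [h] is constant; the finitely many rows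
    [i < i0] stabilize one by one. The chain condition needs this uniformity in [i]. *)
Lemma bounded_homo2_stable (h : nat -> nat -> nat) c :
  (forall k, {homo h ^~ k : i j / (i <= j)%N}) ->
  (forall i, {homo h i : j k / (j <= k)%N}) ->
  (forall i k, (h i k <= c)%N) ->
  exists N, forall k, (N <= k)%N -> forall i, h i k = h i N.
Proof.
move=> mono1 mono2 hc.
have [||_ [[i0 k0] /= ->] maxh] :=
  @bounded_max (fun m => exists p : nat * nat, m = h p.1 p.2) c.
- by exists (h 0%N 0%N), (0%N, 0%N).
- by move=> _ [p ->].
have [N1 hN1] : exists N, forall (i : 'I_i0) k, (N <= k)%N -> h i k = h i N.
  have [i|N hN] := @fin_bound _ (fun (i : 'I_i0) k =>
    forall l, (k <= l)%N -> h i l = h i k).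
    have [N hN] := bounded_homo_stable (mono2 i) (hc i).
    by exists N => k le_k l le_l; rewrite !hN // (leq_trans le_k).
  by exists N => i k le_k; apply: hN.
exists (maxn k0 N1) => k; rewrite geq_max => /andP[le_k0 le_N1] i.
have [lt_i|le_i] := ltnP i i0.
  by rewrite (hN1 (Ordinal lt_i)) // [RHS](hN1 (Ordinal lt_i)) // leq_maxr.
have hmax l : (k0 <= l)%N -> h i l = h i0 k0.
  move=> le_l; apply/eqP; rewrite eqn_leq; apply/andP; split.
    by apply: maxh; exists (i, l).
  exact: leq_trans (mono1 k0 _ _ le_i) (mono2 i _ _ le_l).
by rewrite !hmax ?leq_maxl.
Qed.

End Stabilization.

(** * Leading forms, chain conditions and primeness *)

Section Graded.
Local Open Scope ring_scope.
Variables (K : fieldType) (B : algType K) (G : nat -> B -> Prop).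
Hypothesis grG : is_grading G.

(** The filtration by degree: all components have degree less than [n]. *)
Definition low n (y : B) : Prop :=
  exists c : nat -> B, (forall i, G i (c i)) /\ y = \sum_(i < n) c i.

Lemma low_sub n : subspace (low n).
Proof.
have [sG _ _ _ _] := grG; split=> [|a _ _ [c [Gc ->]] [c' [Gc' ->]]].
  exists (fun _ => 0); split=> [i|]; first by have [] := sG i.
  by rewrite big1.
exists (fun i => a *: c i + c' i); split=> [i|]; first by apply: (sG i).2.
by rewrite scaler_sumr -big_split.
Qed.

Lemma low_all x : exists n, low n x.
Proof.
by have [_ _ _ + _] := grG => /(_ x)[n [c [Gc xE]]]; exists n, c.
Qed.

Lemma low0 x : low 0 x -> x = 0.
Proof. by move=> [c [_ ->]]; rewrite big_ord0. Qed.

Lemma lowS n x : low n.+1 x <-> exists b y, [/\ G n b, low n y & x = b + y].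
Proof.
have [sG _ _ _ _] := grG; split.
  move=> [c [Gc ->]]; exists (c n), (\sum_(i < n) c i).
  by split=> //; [exists c|rewrite big_ord_recr addrC].
move=> [b [_ [Gb [c [Gc ->]] ->]]].
exists (fun i => if i == n then b else c i); split=> [i|].
  by case: eqP => [->|].
rewrite big_ord_recr /= eqxx addrC; congr (_ + _); apply: eq_bigr => i _.
by rewrite ltn_eqF.
Qed.

Lemma low_mull m b n y : G m b -> low n y -> low (m + n) (b * y).
Proof.
have [sG _ GM _ _] := grG => Gb [c [Gc ->]].
exists (fun i => if (m <= i)%N then b * c (i - m)%N else 0); split=> [i|].
  case: ifP => le_mi; last by have [] := sG i.
  by rewrite -{1}(subnKC le_mi); apply: GM.
rewrite big_split_ord /= [X in X + _]big1 ?add0r => [|i _]; last first.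
  by rewrite leqNgt ltn_ord.
by rewrite mulr_sumr; apply: eq_bigr => i _; rewrite leq_addr addKn.
Qed.

Lemma low_mulr n y m b : low n y -> G m b -> low (n + m) (y * b).
Proof.
have [sG _ GM _ _] := grG => -[c [Gc ->]] Gb.
exists (fun i => if (m <= i)%N then c (i - m)%N * b else 0); split=> [i|].
  case: ifP => le_mi; last by have [] := sG i.
  by rewrite -{1}(subnK le_mi); apply: GM.
rewrite addnC big_split_ord /= [X in X + _]big1 ?add0r => [|i _]; last first.
  by rewrite leqNgt ltn_ord.
by rewrite mulr_suml; apply: eq_bigr => i _; rewrite leq_addr addKn.
Qed.

Lemma low_leq m n y : (m <= n)%N -> low m y -> low n y.
Proof.
move/subnKC <-; elim: (n - m)%N => [|k IH] ly; first by rewrite addn0.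
have [sG _ _ _ _] := grG.
rewrite addnS; apply/lowS; exists 0, y; split; rewrite ?add0r //; last exact: IH.
by have [] := sG (m + k)%N.
Qed.

Lemma low_mul m n x y : low m x -> low n y -> low (m + n) (x * y).
Proof.
move=> [c [Gc ->]] ly; rewrite mulr_suml.
apply: subspace_sum; first exact: low_sub.
move=> i _; apply: (@low_leq (i + n)); last exact: low_mull.
by rewrite leq_add2r ltnW.
Qed.

Lemma top_eq0 n b y : G n b -> low n y -> b + y = 0 -> b = 0.
Proof.
have [_ _ _ _ dG] := grG => Gb [c [Gc ->]] b0.
have := dG n.+1 (fun i => if i == n then b else c i) _ _ n (ltnSn n).
rewrite eqxx; apply=> [i|]; first by case: eqP => [->|].
rewrite big_ord_recr /= eqxx addrC -[RHS]b0; congr (_ + _).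
by apply: eq_bigr => i _; rewrite ltn_eqF.
Qed.

Lemma top_component x : x <> 0 ->
  exists n b y, [/\ G n b, low n y, x = b + y & b <> 0].
Proof.
have [n] := low_all x; elim: n x => [x /low0 -> //|n IH x].
move=> /lowS[b [y [Gb ly xE]]] x0.
have [b0|/eqP b0] := eqVneq b 0; last by exists n, b, y.
by apply: IH => //; rewrite xE b0 add0r.
Qed.

(** The leading forms of degree [n] of elements of [L], together with 0; they serve for ideals that
    are not graded. *)
Definition lead n (L : B -> Prop) (b : B) : Prop :=
  G n b /\ exists2 y, low n y & L (b + y).

Lemma lead_sub n L : subspace L -> subspace (lead n L).
Proof.
have [sG _ _ _ _] := grG; move=> sL.
split=> [|a x x' [Gx [y ly Lx]] [Gx' [y' ly' Lx']]].
  split; first by case: (sG n).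
  exists 0; first by case: (low_sub n).
  by rewrite addr0; case: sL.
split; first by apply: (sG n).2.
exists (a *: y + y'); first by apply: (low_sub n).2.
by rewrite addrACA -scalerDr; apply: sL.2.
Qed.

Section Acc.
Variables (c D : nat) (op : {linear B -> B}).
Hypotheses (Gc : forall n, dim_le (G n) c) (D_gt0 : (0 < D)%N).
Hypothesis opG : forall n b, G n b -> G (n + D) (op b).
Hypothesis op_inj : forall n b, G n b -> op b = 0 -> b = 0.

Lemma low_op n y : low n y -> low (n + D) (op y).
Proof.
have [sG _ _ _ _] := grG; move=> [a [Ga ->]].
exists (fun i => if (D <= i)%N then op (a (i - D)%N) else 0); split=> [i|].
  case: ifP => le_mi; last by have [] := sG i.
  by rewrite -{1}(subnK le_mi); apply: opG.
rewrite addnC big_split_ord /= [X in X + _]big1 ?add0r => [|i _]; last first.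
  by rewrite leqNgt ltn_ord.
by rewrite linear_sum; apply: eq_bigr => i _; rewrite leq_addr addKn.
Qed.

(** With [op] the left or right multiplication by a regular element, one argument covers left and
    right ideals. *)
Definition opsub L : Prop := subspace L /\ forall x, L x -> L (op x).

Lemma dimn_lead_op L n : opsub L ->
  (dimn c (lead n L) <= dimn c (lead (n + D) L))%N.
Proof.
move=> [sL opL]; have [v Vv iv] := dimn_attained (lead n L) c.
have leadG m x : lead m L x -> G m x by case.
have lead_c m : forall k (v : 'I_k -> B), (forall i, lead m L (v i)) ->
    indep v -> (k <= c)%N.
  by move=> k v' Vv'; apply: (dim_le_sub (leadG m) (Gc m)).
have Vov i : lead (n + D) L (op (v i)).
  have [Gv [y ly Ly]] := Vv i; split; first exact: opG.
  by exists (op y); [apply: low_op|rewrite -linearD; apply: opL].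
have iov : indep (fun i => op (v i)).
  move=> a av; apply: iv; apply: (@op_inj n).
    have [sG _ _ _ _] := grG; apply: subspace_sum => // i _.
    by apply: subspaceZ => //; case: (Vv i).
  by rewrite linear_sum -[RHS]av; apply: eq_bigr => i _; rewrite linearZ.
have le_c := lead_c (n + D)%N _ _ Vov iov.
apply: (leq_bigmax_cond (Ordinal (le_c : dimn c (lead n L) < c.+1)%N)).
by apply/asboolP; exists (fun i => op (v i)).
Qed.

(** [op] embeds the leading forms of degree [n] into those of degree [n + D], so their dimensions
    increase along each residue class modulo [D] and along the chain; being bounded, they stabilize
    uniformly. Equal leading forms in all degrees force equal members of the chain. *)
Lemma acc_op : acc opsub.
Proof.
move=> L oL incL.
have incL' k l x : (k <= l)%N -> L k x -> L l x.
  by move=> /subnKC <-; elim: (l - k)%N => [|i IH] Lx;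
    rewrite ?addn0 ?addnS //; apply/incL/IH.
have leadL n k l x : (k <= l)%N -> lead n (L k) x -> lead n (L l) x.
  by move=> le_kl [Gx [y ly Ly]]; split=> //; exists y => //; apply: incL' Ly.
have leadG n k x : lead n (L k) x -> G n x by case.
have mono2 n : {homo (fun k => dimn c (lead n (L k))) : k l / (k <= l)%N}.
  move=> k l le_kl; have [v Vv iv] := dimn_attained (lead n (L k)) c.
  have Vv' i := leadL n k l _ le_kl (Vv i).
  have le_c : (dimn c (lead n (L k)) <= c)%N by apply: dimn_le.
  apply: (leq_bigmax_cond (Ordinal (le_c : dimn c (lead n (L k)) < c.+1)%N)).
  by apply/asboolP; exists v.
have mono1 s k : {homo (fun i => dimn c (lead (s + i * D) (L k))) :
    i j / (i <= j)%N}.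
  move=> i j /subnKC <-; elim: (j - i)%N => [|l IH]; first by rewrite addn0.
  rewrite addnS mulSn [(D + _)%N]addnC addnA.
  exact: leq_trans IH (dimn_lead_op _ (oL k)).
have [s|N hN] := @fin_bound 'I_D (fun s k => forall i,
   forall l, (k <= l)%N -> dimn c (lead (s + i * D) (L l)) =
     dimn c (lead (s + i * D) (L k))).
  have [N hN] := @bounded_homo2_stable (fun i k => dimn c (lead (s + i * D) (L k))) c
    (mono1 s) (fun i => mono2 _) (fun i k => dimn_le _ _).
  by exists N => k le_k i l le_l; rewrite !hN // (leq_trans le_k).
have stab n k x : (N <= k)%N -> lead n (L k) x -> lead n (L N) x.
  move=> le_k; apply: (dimn_eq_sub (Gc n)); first exact: leadG.
  - exact/lead_sub/(oL N).1.
  - by move=> y; apply: leadL.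
  rewrite (divn_eq n D) addnC.
  by rewrite (hN (Ordinal (ltn_pmod n D_gt0)) N (leqnn N) (n %/ D)%N k le_k).
exists N => k le_k x; have [n] := low_all x.
(* Subtract an element of [L N] with the same leading form and use induction on the degree. *)
elim: n x => [|n IH] x; first by move=> /low0 -> _; case: (oL N).1.
move=> /lowS[b [y [Gb ly ->]]] Lx.
have [_ [y' ly' Ly']] : lead n (L N) b by apply: (stab n k) => //; split=> //; exists y.
rewrite -(subrK (b + y') (b + y)); apply: subspaceD => //; first exact: (oL N).1.
have e : (b + y) - (b + y') = y - y' by rewrite opprD addrACA subrr add0r.
rewrite e; apply: IH.
  by apply: subspaceB => //; apply: low_sub.
rewrite -e; apply: subspaceB => //; first exact: (oL k).1.
exact: incL' Ly'.
Qed.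

End Acc.

Lemma noetherian_of_regular c D z : (forall n, dim_le (G n) c) -> (0 < D)%N ->
  G D z -> (forall n b, G n b -> z * b = 0 -> b = 0) ->
  (forall n b, G n b -> b * z = 0 -> b = 0) -> noetherian B.
Proof.
have [_ _ GM _ _] := grG => Gc D0 Gz zl zr; split=> L idL incL.
  pose op := fun b : B => z * b.
  have lin : linear op by move=> a x y; rewrite /op mulrDr scalerAr.
  pose opl : {linear B -> B} := HB.pack op (GRing.isLinear.Build K B B _ op lin).
  apply: (@acc_op c D opl) => // [n b Gb|n].
    by rewrite addnC; apply: GM.
  by have [sL _ ML] := idL n; split=> // x; apply: ML.
pose op := fun b : B => b * z.
have lin : linear op by move=> a x y; rewrite /op mulrDl scalerAl.
pose opl : {linear B -> B} := HB.pack op (GRing.isLinear.Build K B B _ op lin).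
apply: (@acc_op c D opl) => // [n b Gb|n]; first exact: GM.
by have [sL ML] := idL n; split=> // x; apply: ML.
Qed.

(** For homogeneous [s], the part of [x * s * y] in the highest degree is [a * s * b], with [a] and
    [b] the top components of [x] and [y]; for a suitable [s] it is nonzero. *)
Lemma prime_of_graded :
  (forall m n a b, G m a -> G n b -> a <> 0 -> b <> 0 ->
     exists l s, G l s /\ a * s * b <> 0) -> prime_algebra B.
Proof.
move=> hom P Q [_ [sP PM]] [_ [sQ QM]] PQ.
have [|nP] := pselect (forall x, P x -> x = 0); first by left.
right=> y Qy; apply: contrapT => y0; apply: nP => x Px; apply: contrapT => x0.
have [m [a [x' [Ga lx xE a0]]]] := top_component x0.
have [n [b [y' [Gb ly yE b0]]]] := top_component y0.
have [l [s [Gs asb]]] := hom _ _ _ _ Ga Gb a0 b0; apply: asb.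
have [_ _ GM _ _] := grG.
have Gas := GM _ _ _ _ Ga Gs.
apply: (top_eq0 (GM _ _ _ _ Gas Gb) (y := a * s * y' + x' * s * b + x' * s * y')).
  apply: subspaceD; [exact: low_sub| |].
    apply: subspaceD; [exact: low_sub|exact: low_mull|].
    by apply: low_mulr => //; apply: low_mulr.
  by apply: low_mul => //; apply: low_mulr.
rewrite -[RHS](PQ (x * s) y) //; last exact: PM.
by rewrite xE yE !mulrDl !mulrDr !addrA.
Qed.

End Graded.

(** * Generic ranks *)

Section GenericRank.
Local Open Scope ring_scope.
Variable K : closedFieldType.

(** [L] and [R] reduce the matrix at [s0] to an identity matrix of the size of its rank, so the
    determinant [q] of the reduced pencil is 1 at [s0]. Where [q] does not vanish, the rank is at
    least as large. *)
Lemma rank_pencil m n (A B : 'M[K]_(m, n)) (s0 : K) : exists2 q : {poly K},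
  q != 0 & forall s, q.[s] != 0 ->
    (\rank (A + s0 *: B)%R <= \rank (A + s *: B)%R)%N.
Proof.
set M := A + s0 *: B.
pose L := pinvmx (col_base M); pose R := pinvmx (row_base M).
pose q := \det (map_mx polyC (L *m A *m R) + 'X *: map_mx polyC (L *m B *m R)).
have qE s : q.[s] = \det (L *m (A + s *: B) *m R).
  rewrite -[LHS]/(horner_eval s q) -det_map_mx; congr (\det _).
  rewrite mulmxDr mulmxDl -scalemxAr -scalemxAl.
  by apply/matrixP => i j; rewrite !mxE /= /horner_eval hornerD hornerM hornerX
    !hornerC.
have LMR : L *m (col_base M *m row_base M) *m R = 1%:M.
  by rewrite mulmxA mulVpmx ?col_base_full // mul1mx mulmxVp ?row_base_free.
rewrite mulmx_base in LMR.
exists q => [|s].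
  apply: contraTneq isT => q0; have := qE s0; rewrite q0 horner0 -/M LMR det1.
  by move/esym/eqP; rewrite oner_eq0.
rewrite qE -unitfE -unitmxE => /mxrank_unit rE.
apply: leq_trans (eq_leq (esym rE)) _.
apply: leq_trans (mxrankM_maxl _ _) _; exact: mxrankM_maxr.
Qed.

(** On the line through a parameter good for all earlier matrices and one good for the last, each
    rank bound can fail only at roots of a nonzero polynomial. As [K] is infinite, some point of the
    line avoids all these roots. *)
Lemma generic_rank (X : Type) (D : nat) (m n r : nat -> nat)
    (M : forall i, (X -> K) -> 'M[K]_(m i, n i)) :
  (forall i a b c c', M i (fun x => a * c x + b * c' x) =
     a *: M i c + b *: M i c') ->
  (forall i, (i < D)%N -> exists c, (r i <= \rank (M i c))%N) ->
  exists c, forall i, (i < D)%N -> (r i <= \rank (M i c))%N.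
Proof.
move=> linM; elim: D => [|D IH] hr; first by exists (fun _ => 0).
have [c hc] := IH (fun i lt_i => hr i (ltnW lt_i)).
have [c' hc'] := hr D (ltnSn D).
have ME i s : M i (fun x => (1 - s) * c x + s * c' x) =
    M i c + s *: (M i c' - M i c).
  by rewrite linM scalerBl scale1r scalerBr addrAC -addrA.
have /fin_all_exists[q hq] (i : 'I_D.+1) : exists q : {poly K}, q != 0 /\
    forall s, q.[s] != 0 ->
    (r i <= \rank (M i (fun x => (1 - s) * c x + s * c' x))%R)%N.
  (* The base point [s = 1] is [c'] and serves the last index; [s = 0] is [c] and serves the
     others. *)
  have [q q0 hq] := rank_pencil (M i c) (M i c' - M i c)
    (if i == ord_max then 1 else 0).
  exists q; split=> // s /hq; rewrite ME; apply: leq_trans.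
  case: eqP => [->|/eqP ne_i]; first by rewrite scale1r addrC subrK.
  rewrite scale0r addr0; apply: hc.
  by rewrite ltn_neqAle -ltnS ltn_ord andbT.
have q0 : \prod_i q i != 0 by apply/prodf_neq0 => i _; case: (hq i).
have /closed_nonrootP[s] := q0; rewrite /root horner_prod => /prodf_neq0 qs.
exists (fun x => (1 - s) * c x + s * c' x) => i lt_i.
by have [_] := hq (Ordinal lt_i); apply; apply: qs.
Qed.

End GenericRank.

Section Spanning.
Local Open Scope ring_scope.
Variables (K : fieldType) (B : algType K).

(** By the rank hypothesis, the row space of [T] meets the left kernel of [Y] trivially. *)
Lemma mulmx_rank_ker m n l (T : 'M[K]_(m, n)) (Y : 'M[K]_(n, l)) k
    (h : 'M[K]_(k, m)) :
  (\rank T <= \rank (T *m Y))%N -> h *m T *m Y = 0 -> h *m T = 0.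
Proof.
move=> le_r hTY; have := mxrank_mul_ker T Y => rE.
have /eqP : \rank (T :&: kermx Y)%MS = 0%N by lia.
rewrite mxrank_eq0 => /eqP cap0; apply/eqP; rewrite -submx0 -cap0 sub_capmx.
by rewrite submxMl; apply/sub_kermxP.
Qed.

(** The matrix [theta] has rank at most [#|X|]. The vectors [v s] for a maximal independent set of
    its rows span [V], since a combination on which all functionals vanish is 0. *)
Lemma dim_le_of_functionals (V : B -> Prop) (S X : finType) (v : S -> B)
    (theta : S -> X -> K) :
  (forall s, V (v s)) -> V 0 ->
  (forall b, V b -> exists a : S -> K, b = \sum_s a s *: v s) ->
  (forall a : S -> K, (forall x, \sum_s a s * theta s x = 0) ->
     \sum_s a s *: v s = 0) -> dim_le V #|X|.
Proof.
move=> Vv V0 spanV inj.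
pose M : 'M[K]_(#|S|, #|X|) := \matrix_(i, j) theta (enum_val i) (enum_val j).
pose f := maxrankfun M; pose r := \rank M.
have le_r : (r <= #|X|)%N by apply: rank_leq_col.
have [g gE] := @ord_pad B 'I_r _ (leq_trans (eq_leq (card_ord r)) le_r).
exists (fun x => oapp (fun k => v (enum_val (f k))) 0 (g x)).
split=> [x|b /spanV[a ->]]; first by case: (g x) => /=.
have /fin_all_exists[d dE] (s : S) : exists d : 'I_r -> K,
    v s = \sum_k d k *: v (enum_val (f k)).
  have : (row (enum_rank s) M <= rowsub f M)%MS.
    by rewrite eq_maxrowsub row_sub.
  case/submxP=> d dE; exists (fun k => d 0 k).
  pose a' s' : K := (s' == s)%:R - \sum_k d 0 k * (s' == enum_val (f k))%:R.
  have sumE (U : lmodType K) (F : S -> U) :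
      \sum_s' a' s' *: F s' = F s - \sum_k d 0 k *: F (enum_val (f k)).
    under eq_bigr => s' _ do rewrite scalerBl.
    rewrite sumrB (bigD1 s) //= eqxx scale1r big1 ?addr0; last first.
      by move=> s' /negPf->; rewrite scale0r.
    congr (_ - _); under eq_bigr => s' _ do rewrite scaler_suml.
    rewrite exchange_big; apply: eq_bigr => k _ /=.
    rewrite (bigD1 (enum_val (f k))) //= eqxx mulr1 big1 ?addr0 // => s' /negPf->.
    by rewrite mulr0 scale0r.
  apply/eqP; rewrite -subr_eq0 -sumE; apply/eqP/inj => x.
  rewrite (sumE K^o (fun s' => theta s' x)); apply/eqP; rewrite subr_eq0.
  have := congr1 (fun N : 'rV_ _ => N 0 (enum_rank x)) dE.
  rewrite !mxE !enum_rankK => ->; apply/eqP; apply: eq_bigr => k _.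
  by rewrite !mxE enum_rankK.
exists (fun x => oapp (fun k => \sum_s a s * d s k) 0 (g x)).
transitivity (\sum_k (\sum_s a s * d s k) *: v (enum_val (f k))).
  under eq_bigr => s _ do rewrite dE scaler_sumr.
  rewrite exchange_big; apply: eq_bigr => k _; rewrite scaler_suml.
  by apply: eq_bigr => s _; rewrite scalerA.
rewrite -gE; apply: eq_bigr => x _; case: (g x) => //=.
by rewrite scaler0.
Qed.

End Spanning.

Section RegularCoefficients.
Local Open Scope ring_scope.
Variables (K : closedFieldType) (T : finType).
Local Notation word := (seq T).

Lemma sum_enum_val (V : zmodType) (S : finType) (F : S -> V) :
  \sum_(i < #|S|) F (enum_val i) = \sum_s F s.
Proof.
rewrite [RHS](reindex_onto enum_val enum_rank) /=.
  by apply: eq_bigl => i; rewrite enum_valK eqxx.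
by move=> s _; rewrite enum_rankK.
Qed.

Lemma sum_tuple_cat (V : zmodType) a b (F : word -> V) :
  \sum_(s : (a + b).-tuple T) F s =
  \sum_(v : a.-tuple T) \sum_(u : b.-tuple T) F (v ++ u).
Proof.
rewrite pair_bigA /=.
pose j (vu : a.-tuple T * b.-tuple T) : (a + b).-tuple T :=
  [tuple of vu.1 ++ vu.2].
have injj : injective j.
  move=> [v u] [v' u'] /(congr1 val) /= /eqP.
  by rewrite eqseq_cat ?size_tuple // => /andP[/eqP/val_inj-> /eqP/val_inj->].
rewrite (reindex j) //; apply: onW_bij; apply: inj_card_bij => //.
by rewrite card_prod !card_tuple expnD.
Qed.

Lemma sum_tuple_delta a (x : word) (F : word -> K) : size x = a ->
  \sum_(u : a.-tuple T) (x == u)%:R * F u = F x.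
Proof.
move=> /eqP sx; rewrite (bigD1 (Tuple sx)) //= eqxx mul1r big1 ?addr0 // => u.
by rewrite -val_eqE /= eq_sym => /negPf->; rewrite mul0r.
Qed.

Variables (D : nat) (p : word -> K).

Local Notation ti i := {: i.-tuple T}.
Let pm i : 'M[K]_(#|ti i|, #|ti (D - i)|) :=
  \matrix_(a < #|ti i|, b < #|ti (D - i)|) p (enum_val a ++ enum_val b).
Let cm i (c : word -> K) : 'M[K]_(#|ti (D - i)|, #|ti i|) :=
  \matrix_(b < #|ti (D - i)|, a < #|ti i|) c (enum_val b ++ enum_val a).

(* For T i the matrix (p (u ++ v)) with |u| = i, the coefficients c form
   matrices C i such that T i C i T i and T i have the same rank. *)
Lemma regular_coefficients : exists c : word -> K, forall i, (i <= D)%N ->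
  (forall h : word -> K,
     (forall y, size y = (D - i)%N ->
        \sum_(v : (D - i).-tuple T) \sum_(u : i.-tuple T)
          (\sum_(u' : i.-tuple T) h u' * p (u' ++ v)) *
          (c (v ++ u) * p (u ++ y)) = 0) ->
     forall v, size v = (D - i)%N ->
       \sum_(u' : i.-tuple T) h u' * p (u' ++ v) = 0) /\
  (forall h : word -> K,
     (forall y, size y = i ->
        \sum_(v : (D - i).-tuple T) \sum_(u : i.-tuple T)
          (p (y ++ v) * c (v ++ u)) *
          (\sum_(v' : (D - i).-tuple T) p (u ++ v') * h v') = 0) ->
     forall u, size u = i ->
       \sum_(v' : (D - i).-tuple T) p (u ++ v') * h v' = 0).
Proof.
have [i a b c c'|i lt_i|c hc] := @generic_rank K word D.+1
  (fun i => #|ti i|) (fun i => #|ti (D - i)|) (fun i => \rank (pm i))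
  (fun i c => pm i *m cm i c *m pm i).
- have -> : cm i (fun x => a * c x + b * c' x) = a *: cm i c + b *: cm i c'.
    by apply/matrixP => x y; rewrite !mxE.
  by rewrite mulmxDr mulmxDl -!scalemxAr -!scalemxAl.
(* For a single [i], a generalized inverse [X] with [T X T = T] serves as coefficient matrix;
   [generic_rank] merges these separate choices into one. *)
- pose X := pinvmx (row_base (pm i)) *m pinvmx (col_base (pm i)).
  exists (fun s => \sum_(v : (D - i).-tuple T) \sum_(u : i.-tuple T)
    (s == v ++ u)%:R * X (enum_rank v) (enum_rank u)).
  have TXT : col_base (pm i) *m row_base (pm i) *m X *m
      (col_base (pm i) *m row_base (pm i)) = col_base (pm i) *m row_base (pm i).
    rewrite /X -(mulmxA (col_base _) (row_base _) (_ *m _)).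
    rewrite (mulmxA (row_base _)) mulmxVp ?row_base_free // mul1mx.
    by rewrite -mulmxA (mulmxA (pinvmx _)) mulVpmx ?col_base_full // mul1mx.
  rewrite mulmx_base in TXT.
  rewrite (_ : cm i _ = X) ?TXT //.
  apply/matrixP => b a; rewrite mxE (bigD1 (enum_val b)) //=.
  rewrite (bigD1 (enum_val a)) //= eqxx mul1r !enum_valK.
  rewrite big1 ?addr0 => [|u nu]; last first.
    by rewrite eqseq_cat ?size_tuple // eqxx val_eqE eq_sym (negPf nu) mul0r.
  rewrite big1 ?addr0 // => v nv; rewrite big1 // => u _.
  by rewrite eqseq_cat ?size_tuple // val_eqE eq_sym (negPf nv) mul0r.
exists c => i le_i; have {hc} hc := hc i le_i; split=> h hh.
  pose H : 'rV[K]_#|ti i| := \row_(a < #|ti i|) h (enum_val a).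
  have HT (v : (D - i).-tuple T) : (H *m pm i) 0 (enum_rank v) =
      \sum_(u' : i.-tuple T) h u' * p (u' ++ v).
    rewrite mxE -[RHS]sum_enum_val; apply: eq_bigr => a _.
    by rewrite !mxE enum_rankK.
  have H0 : H *m pm i *m (cm i c *m pm i) = 0.
    apply/rowP => b; rewrite [RHS]mxE -(enum_valK b); set y := enum_val b.
    rewrite -[RHS](hh y) ?size_tuple // mxE -[RHS]sum_enum_val.
    apply: eq_bigr => v _; rewrite -{1}(enum_valK v) HT [_ (enum_rank y)]mxE.
    rewrite -mulr_sumr; congr (_ * _); rewrite -[RHS]sum_enum_val.
    by apply: eq_bigr => u _; rewrite !mxE enum_rankK.
  have HT0 : H *m pm i = 0.
    by apply: mulmx_rank_ker H0; rewrite mulmxA.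
  by move=> v /eqP sv; have := HT (Tuple sv); rewrite HT0 mxE => /esym.
pose H : 'cV[K]_#|ti (D - i)| := \col_(a < #|ti (D - i)|) h (enum_val a).
have HT (u : i.-tuple T) : (pm i *m H) (enum_rank u) 0 =
    \sum_(v' : (D - i).-tuple T) p (u ++ v') * h v'.
  rewrite mxE -[RHS]sum_enum_val; apply: eq_bigr => a _.
  by rewrite !mxE enum_rankK.
have H0 : pm i *m cm i c *m (pm i *m H) = 0.
  apply/colP => b; rewrite [RHS]mxE -(enum_valK b); set y := enum_val b.
  rewrite -[RHS](hh y) ?size_tuple // mxE [RHS]exchange_big -[RHS]sum_enum_val /=.
  apply: eq_bigr => u _; rewrite -{2}(enum_valK u) HT [_ _ u]mxE.
  rewrite -mulr_suml; congr (_ * _); rewrite -[RHS]sum_enum_val.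
  by apply: eq_bigr => v _; rewrite !mxE enum_rankK.
have HT0 : H^T *m (pm i)^T = 0.
  apply: (@mulmx_rank_ker _ _ _ _ _ ((cm i c)^T *m (pm i)^T)).
    by rewrite -!trmx_mul !mxrank_tr.
  by rewrite -!trmx_mul H0 trmx0.
move=> u /eqP su; have := HT (Tuple su).
by rewrite -[pm i *m H]trmxK trmx_mul HT0 trmx0 mxE => /esym.
Qed.
End RegularCoefficients.

(** * The quotient attached to a periodic functional *)

Section Periodic.
Local Open Scope ring_scope.
Variables (K : closedFieldType) (D : nat) (p : seq 'I_2 -> K) (m0 : seq 'I_2).
Hypotheses (D_gt0 : (0 < D)%N) (sm0 : size m0 = D) (pm0 : p m0 = 1).
Local Notation word := (seq 'I_2).
Local Notation A := (free_alg K 2).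

Definition phi k : word -> K := tens D (nseq k p).

Lemma phi_size k w : size w != (k * D)%N -> phi k w = 0.
Proof. by move=> sw; rewrite /phi tens_size // size_nseq. Qed.

Lemma phiD k l x y : size x = (k * D)%N -> phi (k + l) (x ++ y) = phi k x * phi l y.
Proof. by move=> sx; rewrite /phi nseqD tens_cat // size_nseq. Qed.

Lemma phiDr k l x y : size y = (l * D)%N -> phi (k + l) (x ++ y) = phi k x * phi l y.
Proof.
move=> sy; have [sx|sx] := eqVneq (size x) (k * D)%N; first exact: phiD.
rewrite (phi_size sx) mul0r phi_size //.
by rewrite size_cat sy mulnDl eqn_add2r.
Qed.

Lemma phi1 x : size x = D -> phi 1 x = p x.
Proof. exact: tens1. Qed.

Lemma size_pow k : size (flatten (nseq k m0)) = (k * D)%N.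
Proof. by elim: k => //= k IH; rewrite size_cat IH sm0. Qed.

Lemma phi_pow k l : phi k (flatten (nseq l m0)) = (l == k)%:R.
Proof.
have [<-|ne] := eqVneq l k; last by rewrite phi_size // size_pow eqn_pmul2r.
by elim: l => //= l IH; rewrite (@phiD 1) ?mul1n // IH phi1 // pm0 mul1r.
Qed.

Definition pann (a : A) : Prop := ann phi a.

Lemma pann_ideal : ideal pann. Proof. exact: ann_ideal. Qed.

Lemma pann1 : ~ pann 1.
Proof.
move=> /(_ 0%N [::] [::]); rewrite -wordm_nil lext_wordm /= /phi tens_nil.
by move/eqP; rewrite oner_eq0.
Qed.

Lemma lext_phi_size n a k u v : homogeneous n a ->
  (size u + n + size v)%N != (k * D)%N ->
  lext (fun m => phi k (u ++ m ++ v) : K^o) a = 0.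
Proof.
move=> ha ne; rewrite /lext big_seq big1 // => m /ha sm.
by rewrite phi_size ?scaler0 // !size_cat addnA -fdegE sm.
Qed.

Lemma lextZr (f : word -> K^o) c (a : A) :
  lext (fun m => f m * c : K^o) a = lext f a * c.
Proof. by rewrite /lext mulr_suml; apply: eq_bigr => m _; rewrite scalerAl. Qed.

Lemma lext_sum (J : finType) (f : J -> word -> K^o) (c : J -> K) (a : A) :
  lext (fun m => \sum_j f j m * c j : K^o) a = \sum_j lext (f j) a * c j.
Proof.
rewrite /lext; under eq_bigr => m _ do rewrite scaler_sumr.
rewrite exchange_big; apply: eq_bigr => j _; rewrite mulr_suml.
by apply: eq_bigr => m _; rewrite scalerAl.
Qed.

(** If [phi k] is nonzero on [u a v] and [phi k'] on [u' b v'], then for [w = v u'] the value of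
    [phi (k + k')] on [u a w b v'] is the product of the two. Homogeneity of [a] puts a block
    boundary between [v] and [u']. *)
Lemma pann_prime m n a b : homogeneous m a -> homogeneous n b ->
  ~ pann a -> ~ pann b -> exists w, ~ pann (a * wordm K w * b).
Proof.
move=> ha hb /existsNP[k /existsNP[u /existsNP[v na]]].
move=> /existsNP[k' /existsNP[u' /existsNP[v' nb]]].
exists (v ++ u') => /(_ (k + k')%N u v'); rewrite !lextM.
rewrite (eq_lext (g := fun x => (phi k (u ++ x ++ v) *
    lext (fun y => phi k' (u' ++ y ++ v') : K^o) b : K^o))) => [|x ax].
  by rewrite lextZr => /eqP; rewrite mulf_eq0 => /orP[]/eqP.
rewrite lext_wordm mulrC -lextZr; apply: eq_lext => y _; rewrite mulrC.
rewrite -phiD; first by rewrite -!catA.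
apply/eqP; apply: contra_notT na => ne; rewrite (lext_phi_size ha) //.
by move: ne; rewrite !size_cat addnA -fdegE (ha _ ax).
Qed.

Lemma phi_cut_right k i x y : (i <= D)%N -> size x = (k * D + i)%N ->
  size y = (D - i)%N ->
  phi k.+1 (x ++ y) = phi k (take (k * D) x) * p (drop (k * D) x ++ y).
Proof.
move=> le_i sx sy.
have st : size (take (k * D) x) = (k * D)%N by rewrite size_takel // sx leq_addr.
rewrite -{1}(cat_take_drop (k * D) x) -catA -addn1 phiD // phi1 //.
by rewrite size_cat size_drop sx sy addKn subnKC.
Qed.

Lemma phi_cut_left k i x y : (i <= D)%N -> size x = (k * D + (D - i))%N ->
  size y = i ->
  phi k.+1 (y ++ x) = p (y ++ take (D - i) x) * phi k (drop (D - i) x).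
Proof.
move=> le_i sx sy.
have st : size (take (D - i) x) = (D - i)%N by rewrite size_takel // sx leq_addl.
rewrite -{1}(cat_take_drop (D - i) x) catA -add1n phiD ?phi1 //.
  by rewrite size_cat sy st subnKC.
by rewrite mul1n size_cat sy st subnKC.
Qed.

Variable c : word -> K.
Hypothesis hc : forall i, (i <= D)%N ->
  (forall h : word -> K,
     (forall y, size y = (D - i)%N ->
        \sum_(v : (D - i).-tuple 'I_2) \sum_(u : i.-tuple 'I_2)
          (\sum_(u' : i.-tuple 'I_2) h u' * p (u' ++ v)) *
          (c (v ++ u) * p (u ++ y)) = 0) ->
     forall v, size v = (D - i)%N ->
       \sum_(u' : i.-tuple 'I_2) h u' * p (u' ++ v) = 0) /\
  (forall h : word -> K,
     (forall y, size y = i ->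
        \sum_(v : (D - i).-tuple 'I_2) \sum_(u : i.-tuple 'I_2)
          (p (y ++ v) * c (v ++ u)) *
          (\sum_(v' : (D - i).-tuple 'I_2) p (u ++ v') * h v') = 0) ->
     forall u, size u = i ->
       \sum_(v' : (D - i).-tuple 'I_2) p (u ++ v') * h v' = 0).

Definition zreg : A := \sum_(s : D.-tuple 'I_2) c s *: wordm K s.

Lemma homogeneous_zreg : homogeneous D zreg.
Proof.
apply: homogeneous_sum => s _; apply: homogeneousZ.
by rewrite -{1}(size_tuple s); apply: homogeneous_wordm.
Qed.

Lemma lext_zreg (f : word -> K^o) i : (i <= D)%N -> lext f zreg =
  \sum_(v : (D - i).-tuple 'I_2) \sum_(u : i.-tuple 'I_2) c (v ++ u) * f (v ++ u).
Proof.
move=> le_i; rewrite -(@sum_tuple_cat _ K^o _ _ (fun s => c s * f s)) subnK //.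
by rewrite /zreg linear_sum; apply: eq_bigr => s _; rewrite linearZ /= lext_wordm.
Qed.

(** Let [u a] end at offset [i] of a block. As a function of the [D - i] letters completing that
    block, the value on [u a y] is a row vector [h T], with [T] the matrix of [p] at cut [i]. That
    [a * zreg] is annihilated gives [h T C T = 0], hence [h T = 0] by the choice of [c]. *)
Lemma zreg_right n a : homogeneous n a -> pann (a * zreg) -> pann a.
Proof.
move=> ha haz k u v.
have [sE|ne] := eqVneq (size u + n + size v)%N (k * D)%N; last first.
  exact: (lext_phi_size ha).
set L := (size u + n)%N in sE; pose k' := (L %/ D)%N; pose i := (L %% D)%N.
have LE : L = (k' * D + i)%N by exact: divn_eq.
have lt_i : (i < D)%N by rewrite ltn_mod.
have le_i := ltnW lt_i.
pose h u' := lext (fun m => phi k' (take (k' * D) (u ++ m)) *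
  (drop (k' * D) (u ++ m) == u')%:R : K^o) a.
have sum m : m \in msupp a -> size (u ++ m) = (k' * D + i)%N.
  by move=> /ha sm; rewrite size_cat -LE -fdegE sm.
have gE y : size y = (D - i)%N ->
    lext (fun m => phi k'.+1 (u ++ m ++ y) : K^o) a =
    \sum_(u' : i.-tuple 'I_2) h u' * p (u' ++ y).
  move=> sy; rewrite -lext_sum; apply: eq_lext => m am.
  rewrite catA (phi_cut_right le_i) ?sum //.
  under eq_bigr => u' _ do rewrite -mulrA.
  rewrite -mulr_sumr (@sum_tuple_delta K _ i _ (fun u' => p (u' ++ y))) //.
  by rewrite size_drop sum // addKn.
have g0 y : size y = (D - i)%N ->
    lext (fun m => phi k'.+1 (u ++ m ++ y) : K^o) a = 0.
  move=> sy; rewrite gE //; apply: (hc le_i).1 => // {sy}y sy.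
  rewrite -[RHS](haz k'.+2 u y) lextM.
  transitivity (lext (fun m => \sum_(v : (D - i).-tuple 'I_2)
    phi k'.+1 (u ++ m ++ v) * (\sum_(u0 : i.-tuple 'I_2) c (v ++ u0) * p (u0 ++ y))
    : K^o) a).
    rewrite lext_sum; apply: eq_bigr => v' _; rewrite -mulr_sumr gE //.
    by rewrite size_tuple.
  apply: (@eq_lext K 2 K^o _ _ a) => m am; rewrite (lext_zreg _ le_i).
  apply: eq_bigr => v' _; rewrite mulr_sumr; apply: eq_bigr => u0 _.
  rewrite mulrCA; congr (_ * _); rewrite -phi1; last first.
    by rewrite size_cat sy size_tuple subnKC.
  rewrite -phiD ?addn1; first by rewrite -!catA.
  by rewrite !catA size_cat sum // size_tuple mulSn; lia.
(* If [v] is empty, there is no block to complete; [m0] supplies one, as [p] is 1 on it. *)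
have [v0|v0] := eqVneq v [::].
  have k'k : k = k' by move: sE; rewrite v0 /= addn0 LE; nia.
  have i0 : i = 0%N by move: sE; rewrite v0 /= addn0 LE k'k; lia.
  rewrite -[RHS](g0 m0) ?i0 ?subn0 // v0; apply: eq_lext => m am.
  rewrite cats0 k'k -[k'.+1]addn1 catA phiD ?phi1 ?pm0 ?mulr1 //.
  by rewrite sum // i0 addn0.
have lt_k : (k' < k)%N.
  rewrite -(ltn_pmul2r D_gt0) -sE LE -addnA -[X in (X < _)%N]addn0 ltn_add2l.
  by rewrite addn_gt0 orbC lt0n size_eq0 v0.
have sv : size v = ((D - i) + (k - k'.+1) * D)%N by move: sE; rewrite LE; nia.
rewrite (eq_lext (g := fun m => phi k'.+1 (u ++ m ++ take (D - i) v) *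
   phi (k - k'.+1) (drop (D - i) v) : K^o)) => [|m am].
  by rewrite lextZr g0 ?mul0r // size_takel // sv leq_addr.
rewrite -phiDr; last by rewrite size_drop sv addKn.
by rewrite subnKC // -!catA cat_take_drop.
Qed.

Lemma zreg_left n a : homogeneous n a -> pann (zreg * a) -> pann a.
Proof.
move=> ha haz k u v.
have [sE|ne] := eqVneq (size u + n + size v)%N (k * D)%N; last first.
  exact: (lext_phi_size ha).
(* Blocks are counted from the right here, and [i] ranges over [0 < i <= D], whereas [zreg_right]
   has [0 <= i < D]; so [hc] includes both ends. *)
set L := (n + size v)%N; pose k' := (L %/ D)%N; pose i := (D - L %% D)%N.
have le_i : (i <= D)%N by rewrite leq_subr.
have lt_L : (L %% D < D)%N by rewrite ltn_mod.
have LE : L = (k' * D + (D - i))%N by rewrite {1}(divn_eq L D) subKn // ltnW.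
have i_gt0 : (0 < i)%N by rewrite subn_gt0.
pose h v' := lext (fun m => phi k' (drop (D - i) (m ++ v)) *
  (take (D - i) (m ++ v) == v')%:R : K^o) a.
have smv m : m \in msupp a -> size (m ++ v) = (k' * D + (D - i))%N.
  by move=> /ha sm; rewrite size_cat -LE -fdegE sm.
have gE y : size y = i ->
    lext (fun m => phi k'.+1 (y ++ m ++ v) : K^o) a =
    \sum_(v' : (D - i).-tuple 'I_2) p (y ++ v') * h v'.
  move=> sy; under [RHS]eq_bigr => v' _ do rewrite mulrC.
  rewrite -lext_sum; apply: eq_lext => m am.
  rewrite (phi_cut_left le_i) ?smv //.
  under eq_bigr => v' _ do rewrite -mulrA.
  rewrite -mulr_sumr (@sum_tuple_delta K _ (D - i) _ (fun v' => p (y ++ v'))).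
    by rewrite mulrC.
  by rewrite size_takel // smv // leq_addl.
have g0 y : size y = i ->
    lext (fun m => phi k'.+1 (y ++ m ++ v) : K^o) a = 0.
  move=> sy; rewrite gE //; apply: (hc le_i).2 => // {sy}y sy.
  rewrite -[RHS](haz k'.+2 y v) lextM (lext_zreg _ le_i).
  apply: eq_bigr => v' _; apply: eq_bigr => u0 _.
  rewrite -gE ?size_tuple // -mulrA mulrCA; congr (_ * _).
  rewrite mulrC -lextZr; apply: (@eq_lext K 2 K^o _ _ a) => m am; rewrite mulrC.
  rewrite -phi1; last by rewrite size_cat sy size_tuple subnKC.
  rewrite -phiD ?add1n; first by rewrite -!catA.
  by rewrite size_cat sy size_tuple mul1n subnKC.
have sE' : (size u + (k' * D + (D - i)) = k * D)%N by rewrite -LE /L addnA.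
have [u0|u0] := eqVneq u [::].
  have lt_Di : (D - i < D)%N by rewrite ltn_subrL i_gt0.
  move: sE'; rewrite u0 /= add0n => sE'.
  have k'k : k = k' by nia.
  have i0 : (D - i = 0)%N by move: sE'; rewrite k'k; lia.
  have iD : i = D by apply/eqP; rewrite eqn_leq le_i -subn_eq0 i0.
  rewrite -[RHS](g0 m0) ?iD //; apply: (@eq_lext K 2 K^o _ _ a) => m am.
  by rewrite k'k -[k'.+1]add1n phiD ?phi1 ?pm0 ?mul1r // mul1n.
have k_gt : (k' < k)%N.
  rewrite -(ltn_pmul2r D_gt0) -sE' addnCA -[X in (X < _)%N]addn0 ltn_add2l.
  by rewrite addn_gt0 lt0n size_eq0 u0.
have su : size u = ((k - k'.+1) * D + i)%N.
  have : (D - i + i = D)%N by rewrite subnK.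
  by move: sE'; clearbody i; nia.
set b := ((k - k'.+1) * D)%N in su.
rewrite (eq_lext (g := fun m => phi k'.+1 (drop b u ++ m ++ v) *
   phi (k - k'.+1) (take b u) : K^o)) => [|m am].
  by rewrite lextZr g0 ?mul0r // size_drop su addKn.
rewrite mulrC -phiD; last by rewrite size_takel // su leq_addr.
by rewrite subnK // -[in LHS](cat_take_drop b u) -catA.
Qed.

End Periodic.

(** * Grading, growth, primeness and chain conditions of the quotient *)

Section PeriodicQuotient.
Local Open Scope ring_scope.
Variables (K : closedFieldType) (D : nat) (p : seq 'I_2 -> K).
Hypothesis D_gt0 : (0 < D)%N.
Variables (B : algType K) (psi : {lrmorphism free_alg K 2 -> B}).
Hypotheses (psi_surj : forall b, exists a, b = psi a).
Hypothesis psi_ker : forall a, psi a = 0 <-> pann D p a.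
Local Notation word := (seq 'I_2).
Local Notation A := (free_alg K 2).

Definition imgr (k : nat) : B -> Prop := direct_image psi (homogeneous k).

Lemma imgr_sub k : subspace (imgr k).
Proof.
have [h0 hD] := homogeneous_sub K 2 k.
split=> [|c _ _ [a ha ->] [b hb ->]]; first by exists 0; rewrite ?linear0.
by exists (c *: a + b); rewrite ?linearP //; apply: hD.
Qed.

(** For fixed [k], [u] and [v], the functional sees only the degree [k * D - size u - size v], so
    the components of an element of the kernel lie in the kernel. *)
Lemma imgr_grading : is_grading imgr.
Proof.
split=> [k||m n _ _ [a ha ->] [b hb ->]|b|N c Gc c0 n lt_n].
- exact: imgr_sub.
- exists 1; last by rewrite rmorph1.
  by rewrite -wordm_nil -[0%N]/(size ([::] : word)); apply: homogeneous_wordm.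
- by exists (a * b); rewrite ?rmorphM //; apply: homogeneousM.
- have [a ->] := psi_surj b; have [N aE] := wcomp_sum size a.
  exists N, (fun k => psi (wcomp size k a)); split=> [k|].
    by exists (wcomp size k a) => //; apply: homogeneous_wcomp.
  by rewrite {1}(aE N (leqnn N)) linear_sum.
have [a aE] : exists a, forall k, homogeneous k (a k) /\ c k = psi (a k).
  suff /choice[a ha] : forall k, exists a : A, homogeneous k a /\ c k = psi a.
    by exists a.
  by move=> k; have [x hx ->] := Gc k; exists x.
rewrite (aE n).2; apply/psi_ker => k u v.
have [sE|ne] := eqVneq (size u + n + size v)%N (k * D)%N; last first.
  exact: (lext_phi_size p (aE n).1).
have : pann D p (\sum_(i < N) a i).
  apply/psi_ker; rewrite linear_sum -[RHS]c0; apply: eq_bigr => i _.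
  by rewrite (aE i).2.
move=> /(_ k u v); rewrite linear_sum (bigD1 (Ordinal lt_n)) //= big1 ?addr0 //.
move=> i ne_i; apply: (lext_phi_size p (aE i).1); rewrite -sE eqn_add2r eqn_add2l.
by move: ne_i; rewrite -val_eqE.
Qed.

(** Whole blocks inside [u] or [v] contribute scalar factors, so only the pieces shorter than [D]
    next to the element count; their number does not depend on the degree. *)
Lemma imgr_growth : linear_growth imgr.
Proof.
(* A word shorter than [D] is encoded as a [D]-tuple with a truncation length. *)
pose X := ((D.-tuple 'I_2 * 'I_D) * (D.-tuple 'I_2 * 'I_D))%type.
exists #|{: X}| => n.
apply: (@dim_le_of_functionals _ _ _ (n.-tuple 'I_2) X
  (fun w => psi (wordm K w))
  (fun w x => phi D p ((x.1.2 + n + x.2.2) %/ D)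
                  (take x.1.2 x.1.1 ++ w ++ take x.2.2 x.2.1))).
- move=> w; exists (wordm K w) => //.
  by rewrite -{1}(size_tuple w); apply: homogeneous_wordm.
- by have [] := imgr_sub n.
- move=> _ [a ha ->]; exists (fun w : n.-tuple 'I_2 => a@_(FMonom w)).
  rewrite {1}(wordm_sum a) (homogeneous_tuple ha) linear_sum.
  by apply: eq_bigr => w _; rewrite linearZ.
move=> a aX; transitivity (psi (\sum_w a w *: wordm K w)).
  by rewrite linear_sum; apply: eq_bigr => w _; rewrite linearZ.
apply/psi_ker => k u v; rewrite linear_sum.
have lextE (w : n.-tuple 'I_2) :
  lext (fun m => phi D p k (u ++ m ++ v) : K^o) (a w *: wordm K w) =
  a w * phi D p k (u ++ w ++ v) by rewrite linearZ /= lext_wordm.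
rewrite (eq_bigr _ (fun w _ => lextE w)).
have [sE|ne] := eqVneq (size u + n + size v)%N (k * D)%N; last first.
  rewrite big1 // => w _; rewrite phi_size ?mulr0 //.
  by rewrite !size_cat size_tuple addnA.
have lt_u : (size u %% D < D)%N by rewrite ltn_mod.
have lt_v : (size v %% D < D)%N by rewrite ltn_mod.
pose k1 := (size u %/ D)%N; pose k2 := (size v %/ D)%N.
have uE : size u = (k1 * D + size u %% D)%N by exact: divn_eq.
have vE : size v = (k2 * D + size v %% D)%N by exact: divn_eq.
pose u' := drop (k1 * D) u; pose v' := take (size v %% D) v.
have su' : size u' = (size u %% D)%N by rewrite size_drop {1}uE addKn.
have sv' : size v' = (size v %% D)%N by rewrite size_takel // leq_mod.
have pad (x : word) : (size x < D)%N -> exists t : D.-tuple 'I_2, take (size x) t = x.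
  move=> lt_x; have st : size (x ++ nseq (D - size x) ord0) == D.
    by rewrite size_cat size_nseq subnKC // ltnW.
  by exists (Tuple st); rewrite /= take_size_cat.
have [|t1 t1E] := pad u'; first by rewrite su'.
have [|t2 t2E] := pad v'; first by rewrite sv'.
have := aX ((t1, Ordinal lt_u), (t2, Ordinal lt_v)) => /=.
rewrite -su' -sv' t1E t2E; set k' := (_ %/ D)%N => aX0.
have k'E : (k' * D)%N = (size u' + n + size v')%N.
  have e : (size u' + n + size v' + (k1 + k2) * D = k * D)%N.
    rewrite -sE su' sv' mulnDl; move: uE vE.
    by move: (size u %% D)%N (size v %% D)%N (k1 * D)%N (k2 * D)%N; lia.
  rewrite /k' divnK // -(dvdn_addl _ (dvdn_mull (k1 + k2) (dvdnn D))) e.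
  exact: dvdn_mull.
have kE : k = (k1 + k' + k2)%N.
  apply/eqP; rewrite -(eqn_pmul2r D_gt0) -sE !mulnDl k'E su' sv'; apply/eqP.
  move: uE vE.
  by move: (size u %% D)%N (size v %% D)%N (k1 * D)%N (k2 * D)%N; lia.
transitivity (phi D p k1 (take (k1 * D) u) * (\sum_w a w *
    phi D p k' (u' ++ w ++ v')) * phi D p k2 (drop (size v %% D) v)).
  rewrite mulr_sumr mulr_suml; apply: eq_bigr => w _.
  rewrite mulrCA -mulrA; congr (_ * _); rewrite kE.
  rewrite -phiD; last by rewrite size_takel // uE leq_addr.
  rewrite -phiDr; last by rewrite size_drop {1}vE addnK.
  by rewrite -!catA cat_take_drop [in RHS]catA cat_take_drop.
by rewrite aX0 mulr0 mul0r.
Qed.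

Lemma imgr_prime : prime_algebra B.
Proof.
apply: (prime_of_graded imgr_grading).
move=> m n _ _ [a ha ->] [b hb ->] a0 b0.
have na : ~ pann D p a by move/psi_ker.
have nb : ~ pann D p b by move/psi_ker.
have [w nw] := pann_prime ha hb na nb.
exists (size w), (psi (wordm K w)); split.
  by exists (wordm K w) => //; apply: homogeneous_wordm.
by rewrite -!rmorphM => /psi_ker.
Qed.

Variable m0 : word.
Hypotheses (sm0 : size m0 = D) (pm0 : p m0 = 1).

(** The powers of [m0] are dual to the functionals [phi k], hence independent. *)
Lemma imgr_infinite : infinite_dimensional B.
Proof.
move=> c Bc; pose v (i : 'I_c.+1) := psi (wordm K (flatten (nseq i m0))).
have iv : indep v.
  move=> a av i.
  have /psi_ker/(_ (i : nat) [::] [::]) :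
      psi (\sum_i a i *: wordm K (flatten (nseq i m0))) = 0.
    by rewrite linear_sum -[RHS]av; apply: eq_bigr => j _; rewrite linearZ.
  rewrite linear_sum (bigD1 i) //= big1 => [|j ne_j].
    rewrite addr0 linearZ /= lext_wordm /= cats0 phi_pow // eqxx.
    by rewrite -[_ *: _]/(_ * _) mulr1.
  rewrite linearZ /= lext_wordm /= cats0 phi_pow // val_eqE (negPf ne_j).
  by rewrite scaler0.
by have := indep_bound Bc (fun i => I) iv; rewrite ltnn.
Qed.

Lemma imgr_noetherian : noetherian B.
Proof.
have [c hc] := regular_coefficients D p.
have [N hN] := imgr_growth.
apply: (noetherian_of_regular imgr_grading hN D_gt0 (z := psi (zreg D c))).
- by exists (zreg D c) => //; apply: homogeneous_zreg.
- move=> n _ [a ha ->]; rewrite -rmorphM => /psi_ker az.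
  by apply/psi_ker; apply: (zreg_left D_gt0 sm0 pm0 hc ha).
- move=> n _ [a ha ->]; rewrite -rmorphM => /psi_ker az.
  by apply/psi_ker; apply: (zreg_right D_gt0 sm0 pm0 hc ha).
Qed.

End PeriodicQuotient.

Section ImageAlgebra.
Local Open Scope ring_scope.
Variables (K : fieldType) (A R : algType K) (pi : {lrmorphism A -> R}).
Hypothesis pi_surj : forall x, exists a, x = pi a.
Variable J : A -> Prop.
Hypotheses (idJ : ideal J) (J1 : ~ J 1) (kerJ : forall a, pi a = 0 -> J a).

(** [J] contains the kernel of [pi], so the preimage of its image is [J] itself. *)
Lemma quotient_of_image : exists (B : algType K) (phi : {lrmorphism R -> B}),
  (forall b, exists x, b = phi x) /\ forall a, phi (pi a) = 0 <-> J a.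
Proof.
have [[sJ _ JMl] [_ JMr]] := idJ; have [J0 JD] := sJ.
have JR a : direct_image pi J (pi a) -> J a.
  move=> [b Jb /eqP]; rewrite -subr_eq0 -rmorphB => /eqP/kerJ Jab.
  by rewrite -(subrK b a); apply: subspaceD.
have sub : subspace (direct_image pi J).
  split; first by exists 0; rewrite ?linear0.
  move=> c _ _ [a Ja ->] [b Jb ->].
  by exists (c *: a + b); rewrite ?linearP //; apply: JD.
have idR : ideal (direct_image pi J).
  split; split=> //.
    move=> s _ _ [a Ja ->]; have [t ->] := pi_surj s.
    by exists (t * a); rewrite ?rmorphM //; apply: JMl.
  move=> s _ [a Ja ->]; have [t ->] := pi_surj s.
  by exists (a * t); rewrite ?rmorphM //; apply: JMr.
have [|B [phi [phi_surj phi_ker]]] := quotient_algebra idR.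
  by rewrite -(rmorph1 pi) => /JR.
exists B, phi; split=> // a; rewrite phi_ker; split=> [/JR //|Ja].
by exists a.
Qed.

End ImageAlgebra.

Section Augmentation.
Local Open Scope ring_scope.

Lemma augmentation_sub (K : fieldType) n : subspace (@augmentation K n).
Proof.
split=> [|c p q hp hq]; first by rewrite /augmentation mcoeff0.
by rewrite /augmentation mcoeffD mcoeffZ hp hq mulr0 addr0.
Qed.

Lemma augmentationM (K : fieldType) n (p q : free_alg K n) :
  augmentation q -> augmentation (p * q).
Proof.
rewrite /augmentation => hq.
by rewrite (mcoeff1g_is_multiplicative _ _).1 hq mulr0.
Qed.

Lemma augmentation_wordm (K : fieldType) n (w : seq 'I_n) :
  (0 < size w)%N -> augmentation (wordm K w).
Proof.
move=> sw; rewrite /augmentation /wordm mcoeffU1; case: eqP => // e.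
by move: sw; rewrite -[w]/(fmonom_val (FMonom w)) e fm1.
Qed.

End Augmentation.

Theorem theorem7p1 (K : closedFieldType) (xi : nat)
  (f : 'I_xi -> free_alg K 2) (d : 'I_xi -> nat) (r e : nat -> nat)
  (* A/I, presented by a surjection pi with kernel I := generated_ideal f *)
  (R : algType K) (pi : {lrmorphism free_alg K 2 -> R})
  (hpi : is_quotient (generated_ideal f) pi)
  (hf : forall j, homogeneous (d j) (f j))
  (hd : forall j, 1 < d j)
  (hr : forall i, r i = #|[set j : 'I_xi | 2 ^ i < d j <= 2 ^ i.+1]|)
  (* the inequalities 2^n + 2^(n-1) + 2^(n-2) < k < 2^(n+1) + 2^n, the first
     one multiplied by 4 because n - 1 and n - 2 may be negative *)
  (hgap : forall n j,
     ~~ [&& 2 ^ n.+2 + 2 ^ n.+1 + 2 ^ n < 4 * d j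
          & d j < 2 ^ n.+1 + 2 ^ n])
  (* The truncated subtraction is harmless: if n < m + 3, then the upper
     bound is 2 instead of a number between 1 and 2, and in both readings it
     contradicts the lower bound, which is at least 16. *)
  (hgrowth : forall n m, r n != 0 -> m = 0 \/ r m != 0 -> m < n ->
     2 ^ (3 * n + 4) * \prod_(i < n | r i != 0) r i ^ 32
       < r n < 2 ^ (2 ^ (n - m - 3)))
  (he : forall n, r n != 0 -> 1 <= e n <= n - 1)
  (* the sets S_n = {n-1-e(n), ..., n-1} for n in Y *)
  (hS : forall n n', r n != 0 -> r n' != 0 -> n != n' ->
     forall k, ~ (n - 1 - e n <= k <= n - 1 /\ n' - 1 - e n' <= k <= n' - 1))
  (hineq : forall n, r n != 0 ->
     r n * 2 ^ (3 * n + 4) * \prod_(k < n | r k != 0) 2 ^ (2 ^ (e k + 2))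
       <= 2 ^ (2 ^ (e n - 1))) :
  [/\ exists (k : nat) (w : 'I_2 -> k.-tuple 'I_2) (S : R -> Prop),
        [/\ subalgebra S,
            graded_subspace (fun n => direct_image pi (homogeneous n)) S
          & freely_generated S (fun i => pi (monomial K (w i)))],
      (* for the algebra with unit A/I, and for its ideal of elements without
         constant term, which is A/I when algebras need not have a unit *)
      ~ is_jacobson_radical (@whole K R),
      ~ is_jacobson_radical (direct_image pi (@augmentation K 2))
    & exists (B : algType K) (G : nat -> B -> Prop)
        (phi : {lrmorphism R -> B}),
        [/\ forall b, exists x, b = phi x,
            is_grading G,
            linear_growth G
          & [/\ prime_algebra B, infinite_dimensional B & noetherian B]]].
Proof.
have [D [ss [sp [D_gt0 [P [m [sm Pm kP _ _]]]]]]] :=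
  @stage_final K xi (fun j w => (f j)@_(FMonom w))%R d r e hd hr hgap he hS hineq.
have Pf j : ann (fun c : seq 'I_2 => tens D (map P c)) (f j).
  apply: (ann_homogeneous (hf j)) => c.
  by apply: (kP (d j) (fun w => (f j)@_(FMonom w))%R); exists j.
have [pi_surj _] := hpi.
split.
- by exists D; apply: (free_subalgebra hpi D_gt0 sm Pm Pf).
(* With [e = 1] all elements [s - s * e] are 0. *)
- apply: (@not_jacobson_radical _ _ _ 1%R) => // s _.
  by rewrite mulr1 subrr; apply/eqP/oner_neq0.
- have [a0 aD] := augmentation_sub K 2.
  apply: (@not_jacobson_radical _ _ _ (pi (wordm K (m ord0)))).
  + split; first by exists 0%R; rewrite ?linear0.
    move=> c _ _ [a ha ->] [b hb ->].
    by exists (c *: a + b)%R; rewrite ?linearP //; apply: aD.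
  + move=> _ _ [a _ ->] [b hb ->].
    by exists (a * b)%R; rewrite ?rmorphM //; apply: augmentationM.
  + by exists (wordm K (m ord0)) => //; apply: augmentation_wordm; rewrite sm.
  + by move=> _ [a ha ->]; apply: (wordm_not_quasiregular hpi D_gt0 sm Pm Pf).
have p1 : P ord0 (m ord0) = 1%R by rewrite Pm.
(* The powers of [P ord0] are among the tensor products that vanish on the relations. *)
have kerJ a : pi a = 0%R -> pann D (P ord0) a.
  move=> /(ann_pi hpi Pf) pa k u v; rewrite -[RHS](pa (nseq k ord0) u v).
  by apply: eq_lext => w _; rewrite /phi map_nseq.
have [B [phi [phi_surj phi_ker]]] :=
  quotient_of_image pi_surj (pann_ideal D (P ord0)) (@pann1 K D (P ord0)) kerJ.
pose psi : {lrmorphism free_alg K 2 -> B} := phi \o pi.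
have psi_surj b : exists a, b = psi a.
  by have [x ->] := phi_surj b; have [a ->] := pi_surj x; exists a.
exists B, (imgr psi), phi; split=> //.
- exact: (imgr_grading psi_surj phi_ker).
- exact: (imgr_growth (psi := psi) D_gt0 phi_ker).
split.
- exact: (imgr_prime psi_surj phi_ker).
- exact: (imgr_infinite D_gt0 (psi := psi) phi_ker (sm ord0) p1).
- exact: (imgr_noetherian D_gt0 psi_surj phi_ker (sm ord0) p1).
Qed.
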